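(* Consider the AURWM regime (defined in the context) with $n=\lfloor p^k\rfloor$, $0<k<1$. Let $r>1$ and write $\delta=r-1$. Then there exists a universal positive constant $C_0$ such that whenever $$s<C_0\,\min\left\{2k,\ \frac{\delta^2}{\left\{(1+0.75\,\delta)^{1/2}+(1+0.5\,\delta)^{1/2}\right\}^2}\right\}\log p,$$ we have $$\lim_{p\to\infty}\ \sup_{\beta\in\mathcal{M}_s^a}\ \mathbb{P}_\beta\big(\widehat{\mathcal S}_{\rm best}\neq\mathcal{S}(\beta)\big)=0.$$
   Context: Model: $Y=X\beta+E$, where $X\in\mathbb{R}^{n\times p}$ has i.i.d. rows $x_i\sim N_p(0,I_p)$, $E$ has i.i.d. $N(0,1)$ entries, and $X,E$ are independent. $\mathbb{P}_\beta$ is the law of the data when the coefficient vector is $\beta\in\mathbb{R}^p$. $\mathcal{S}(v)=\{j: v_j\neq 0\}$ is the support of $v\in\mathbb{R}^p$, and $\|v\|_0=|\mathcal{S}(v)|$. Signal class: $\mathcal{M}_s^a=\{\beta\in\mathbb{R}^p:\ \|\beta\|_0=s,\ \min_{j\in\mathcal{S}(\beta)}|\beta_j|\ge a\}$. AURWM regime: $p\to\infty$, $n=\lfloor p^k\rfloor$ with fixed $k\in(0,1)$, sparsity $s=s_p=O(\log p)$, and $a=\left(\frac{2r\log p}{n}\right)^{1/2}$ where $r>0$ is a fixed constant. ''Universal'' means not depending on $k,r,n,p,s,\beta$. Best subset selection (BSS) with known sparsity $s$: for $\mathcal{D}\subseteq[p]$ let $X_{\mathcal D}$ be the submatrix of $X$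 with columns indexed by $\mathcal D$ and $P_{\mathcal D}=X_{\mathcal D}(X_{\mathcal D}^\top X_{\mathcal D})^{-1}X_{\mathcal D}^\top$ the orthogonal projection onto its column space. Then $$\widehat{\mathcal S}_{\rm best}=\arg\min_{\mathcal D\subseteq[p]:|\mathcal D|=s}n^{-1}Y^\top(I_n-P_{\mathcal D})Y=\arg\max_{\mathcal D\subseteq[p]:|\mathcal D|=s}n^{-1}Y^\top P_{\mathcal D}Y.$$ *)

(* Defs.v *)
From HB Require Import structures.
From mathcomp Require Import all_boot all_order all_algebra.
From mathcomp Require Import all_classical all_reals all_analysis.

Set Implicit Arguments.
Unset Strict Implicit.
Unset Printing Implicit Defensive.

Import Order.TTheory GRing.Theory Num.Theory.
Import numFieldNormedType.Exports.

Local Open Scope classical_set_scope.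
Local Open Scope ring_scope.

Section independence.
Context {d : measure_display} {T : measurableType d} {R : realType}.
Variable P : probability T R.

Definition mutually_independent {I : finType} (G : I -> set (set T)) : Prop :=
  forall (J : {set I}) (A : I -> set T), (forall i, i \in J -> G i (A i)) ->
    P (\bigcap_(i in [set` J]) A i) = (\prod_(i in J) P (A i))%E.

Definition independent_classes (F G : set (set T)) : Prop :=
  forall A B, F A -> G B -> P (A `&` B) = (P A * P B)%E.

(* The sigma-algebra generated by the family [Z], that is, by the random
   vector with coordinates [Z i]. *)
Definition sigma_family {I : Type} (Z : I -> {RV P >-> R}) : set (set T) :=
  <<s \bigcup_i g_sigma_algebra_preimage (Z i) >>.

(* Equality of laws is only required on Borel sets: the library's measures are
   total functions, with irrelevant values on non-measurable sets. *)
Definition std_normal (Z : {RV P >-> R}) : Prop :=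
  forall B : set R, measurable B -> distribution P Z B = normal_prob 0 1 B.

Definition std_normal_vector {p : nat} (Z : 'I_p -> {RV P >-> R}) : Prop :=
  (forall j, std_normal (Z j)) /\
  mutually_independent (fun j => g_sigma_algebra_preimage (Z j)).

End independence.

Section linear_model.
Context {d : measure_display} {T : measurableType d} {R : realType}.
Variables (P : probability T R) (n p : nat).
Variables (X : 'I_n -> 'I_p -> {RV P >-> R}) (E : 'I_n -> {RV P >-> R}).

Record gaussian_model : Prop := GaussianModel {
  rows_std_normal : forall i, std_normal_vector (X i) ;
  rows_independent : mutually_independent P (fun i => sigma_family (X i)) ;
  noise_std_normal : forall i, std_normal (E i) ;
  noise_independent :
    mutually_independent P (fun i => g_sigma_algebra_preimage (E i)) ;
  design_noise_independent :
    independent_classes P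
      (sigma_family (fun ij : 'I_n * 'I_p => X ij.1 ij.2)) (sigma_family E)
}.

Definition design (w : T) : 'M[R]_(n, p) := \matrix_(i, j) X i j w.

Definition noise (w : T) : 'cV[R]_n := \col_i E i w.

Definition response (b : 'cV[R]_p) (w : T) : 'cV[R]_n :=
  design w *m b + noise w.

End linear_model.

Section best_subset_selection.
Context {R : realType} {n p : nat}.

Definition supp (b : 'cV[R]_p) : {set 'I_p} := finset (fun j => b j 0 != 0).

(* M_s^a; if s = 0 the condition on the minimum is vacuous. *)
Definition signal_class (s : nat) (a : R) : set 'cV[R]_p :=
  [set b | #|supp b| = s /\ forall j, j \in supp b -> a <= `|b j 0|].

Definition subdesign (X : 'M[R]_(n, p)) (D : {set 'I_p}) : 'M[R]_(n, #|D|) :=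
  colsub (fun j : 'I_#|D| => enum_val j) X.

(* [invmx A] is [A] when [A] is singular, so [proj] is the orthogonal
   projection onto the column space of [subdesign X D] only when the columns
   are linearly independent. For a Gaussian design and #|D| <= n this holds
   almost surely. *)
Definition proj (X : 'M[R]_(n, p)) (D : {set 'I_p}) : 'M[R]_n :=
  let XD := subdesign X D in XD *m invmx (XD^T *m XD) *m XD^T.

Definition rss (X : 'M[R]_(n, p)) (Y : 'cV[R]_n) (D : {set 'I_p}) : R :=
  n%:R^-1 * (Y^T *m (1%:M - proj X D) *m Y) 0 0.

Definition is_best_subset (s : nat) (X : 'M[R]_(n, p)) (Y : 'cV[R]_n)
    (D : {set 'I_p}) : Prop :=
  #|D| = s /\ forall D' : {set 'I_p}, #|D'| = s -> rss X Y D <= rss X Y D'.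

(* The rule breaking ties in the argmin is left arbitrary. No subset of size s
   exists when s > p, in which case nothing is required. *)
Definition bss_rule (s : nat)
    (S : 'M[R]_(n, p) -> 'cV[R]_n -> {set 'I_p}) : Prop :=
  (s <= p)%N -> forall X Y, is_best_subset s X Y (S X Y).

End best_subset_selection.

Section error.
Context {d : measure_display} {T : measurableType d} {R : realType}.
Variables (P : probability T R) (n p : nat).
Variables (X : 'I_n -> 'I_p -> {RV P >-> R}) (E : 'I_n -> {RV P >-> R}).
Variable S : 'M[R]_(n, p) -> 'cV[R]_n -> {set 'I_p}.

Definition estimator_measurable : Prop :=
  forall (b : 'cV[R]_p) (D : {set 'I_p}),
    measurable [set w | S (design X w) (response X E b w) = D].

Definition selection_error (b : 'cV[R]_p) : \bar R :=
  P [set w | S (design X w) (response X E b w) <> supp b].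

Definition max_selection_error (s : nat) (a : R) : \bar R :=
  ereal_sup [set selection_error b | b in signal_class s a].

End error.

Section regime.
Context {R : realType}.

Definition nobs (k : R) (p : nat) : nat := Num.truncn (p%:R `^ k).

Definition min_signal (k r : R) (p : nat) : R :=
  Num.sqrt (2 * r * ln p%:R / (nobs k p)%:R).

Definition sparsity_bound (k delta : R) : R :=
  Num.min (2 * k)
    (delta ^+ 2 /
     (Num.sqrt (1 + 3 / 4 * delta) + Num.sqrt (1 + 1 / 2 * delta)) ^+ 2).

End regime.

(* Main.v *)
Require Import Defs.
From HB Require Import structures.
From mathcomp Require Import all_boot all_order all_algebra.
From mathcomp Require Import all_classical all_reals all_analysis.
From mathcomp Require Import measurable_realfun ring lra.

Set Implicit Arguments.
Unset Strict Implicit.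
Unset Printing Implicit Defensive.

Import Order.TTheory GRing.Theory Num.Theory.
Import numFieldNormedType.Exports.

Local Open Scope classical_set_scope.
Local Open Scope ring_scope.

(** Best subset selection fails only if some set D of size s, different from
    the support S, has a residual sum of squares at most that of S. Write
    L = ln p and z = X^T e for the scores of the noise e. The residual sum of
    squares over D is the minimum of |e - X h|^2 over the vectors b + h that
    live on D, and
      |e - X h|^2 = |e|^2 - 2 <z, h> + |X h|^2.
    The design is nearly orthogonal: since n grows like a power of p, all the
    p^2 entries of X^T X - n I are at most n eta with probability close to 1,
    even for eta as small as a multiple of L^-2. As s = O(L), Gershgorin's
    bound then gives |X h|^2 = n (1 + o(1)) |h|^2 for all h with at most 2s
    nonzero entries, and the problem decouples into one-dimensional quadratics
    in the coordinates h_j: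
    - an index of S missing from D costs n beta_j^2, up to lower order terms,
      which is at least 2 r L;
    - an index of D outside S gains at most z_j^2 / n, which is at most
      (2 + o(1)) L for all j at once, because it is asymptotically the square
      of a standard normal variable and there are p of them;
    - an index common to D and S gains nearly as much for S as for D.
    The first two kinds are equally numerous, so S wins as soon as r > 1. This
    is [support_beats_subset]; nothing in it is random.

    The two random ingredients are bounds on sums of n independent products of
    independent standard normal variables, for two distinct columns of X or a
    column of X and the noise, and on sums of squares, for one column. Their
    moment generating functions are explicit, and the Chernoff bounds
    [tail_sum_mul] and [tail_sum_sqr] follow once expectations factorize over
    independent pairs ([expectation_prod_pairs]). A union bound gives
    [selection_error_le], and [max_selection_error_le] reduces it to O(1 / L),
    uniformly over the signal class. *)

(** * Squared norms and incoherent designs *)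

Section squared_norm.
Context {R : realType}.

Definition sqnorm {m : nat} (u : 'cV[R]_m) : R := (u^T *m u) 0 0.

Lemma sqnormE m (u : 'cV[R]_m) : sqnorm u = \sum_i u i 0 ^+ 2.
Proof. by rewrite /sqnorm mxE; apply: eq_bigr => i _; rewrite mxE expr2. Qed.

Lemma sqnorm_ge0 m (u : 'cV[R]_m) : 0 <= sqnorm u.
Proof. by rewrite sqnormE sumr_ge0// => i _; exact: sqr_ge0. Qed.

Lemma sqnorm_eq0 m (u : 'cV[R]_m) : sqnorm u <= 0 -> u = 0.
Proof.
move=> u0; have /eqP : sqnorm u = 0 by apply/eqP; rewrite eq_le u0 sqnorm_ge0.
rewrite sqnormE psumr_eq0; last by move=> i _; exact: sqr_ge0.
move=> /allP h; apply/matrixP => i j; rewrite ord1 mxE.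
by apply/eqP; rewrite -sqrf_eq0; apply: h; rewrite mem_index_enum.
Qed.

Lemma sqnormB m p (A : 'M[R]_(m, p)) (e : 'cV[R]_m) (h : 'cV[R]_p) :
  sqnorm (e - A *m h) =
  sqnorm e - 2 * (\sum_j (A^T *m e) j 0 * h j 0) + sqnorm (A *m h).
Proof.
have -> : \sum_j (A^T *m e) j 0 * h j 0 = \sum_i e i 0 * (A *m h) i 0.
  transitivity ((h^T *m (A^T *m e)) 0 0).
    by rewrite [RHS]mxE; apply: eq_bigr => j _; rewrite [h^T _ _]mxE mulrC.
  rewrite mulmxA -trmx_mul mxE.
  by apply: eq_bigr => i _; rewrite [_^T _ _]mxE mulrC.
rewrite !sqnormE mulr_sumr -sumrB -big_split/=.
by apply: eq_bigr => i _; rewrite !mxE; ring.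
Qed.

Lemma sum_mem_card (I : finType) (A : {set I}) :
  \sum_i (i \in A)%:R = #|A|%:R :> R.
Proof.
rewrite -sum1_card natr_sum [RHS]big_mkcond/=.
by apply: eq_bigr => i _; case: ifP.
Qed.

(** Gershgorin's bound: the entries of X^T X - n I contribute at most
    n eta (|h_1| + ... + |h_p|)^2, and the square is at most #|A| |h|^2 by the
    Cauchy-Schwarz inequality. *)
Lemma coherence_sqnorm n p (X : 'M[R]_(n, p)) (A : {set 'I_p}) (h : 'cV[R]_p)
    (eta : R) :
  (forall i j, `|(X^T *m X) i j - n%:R *+ (i == j)| <= n%:R * eta) ->
  (forall j, j \notin A -> h j 0 = 0) ->
  `|sqnorm (X *m h) - n%:R * sqnorm h| <= n%:R * eta * #|A|%:R * sqnorm h.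
Proof.
move=> coh hA.
have -> : sqnorm (X *m h) - n%:R * sqnorm h =
    \sum_i \sum_j h i 0 * h j 0 * ((X^T *m X) i j - n%:R *+ (i == j)).
  have -> : sqnorm (X *m h) = \sum_i \sum_j h i 0 * h j 0 * (X^T *m X) i j.
    rewrite /sqnorm trmx_mul mulmxA -(mulmxA h^T) mxE exchange_big/=.
    apply: eq_bigr => j _; rewrite mxE mulr_suml; apply: eq_bigr => i _.
    by rewrite [h^T _ _]mxE; ring.
  have -> : n%:R * sqnorm h =
      \sum_i \sum_j h i 0 * h j 0 * (n%:R *+ (i == j)).
    rewrite sqnormE mulr_sumr; apply: eq_bigr => i _.
    rewrite (bigD1 i)//= eqxx big1 ?addr0; first by rewrite mulr1n; ring.
    by move=> j /negbTE; rewrite eq_sym => ->; rewrite mulr0n mulr0.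
  rewrite -sumrB; apply: eq_bigr => i _; rewrite -sumrB.
  by apply: eq_bigr => j _; rewrite mulrBr.
have neta : 0 <= n%:R * eta \/ forall j, h j 0 = 0.
  case: (posnP p) => [p0|p0];
    first by right=> j; have := ltn_ord j; rewrite [X in (_ < X)%N]p0.
  left; exact: le_trans (coh (Ordinal p0) (Ordinal p0)).
case: neta => [neta|h0]; last first.
  rewrite big1 ?normr0; last first.
    by move=> i _; rewrite big1// => j _; rewrite h0 !mul0r.
  by rewrite sqnormE big1 ?mulr0// => i _; rewrite h0 expr0n.
(* 2 |h_i h_j| <= h_i^2 + h_j^2, and only the indices of A contribute *)
pose q i : R := h i 0 ^+ 2.
have le1 i j : `|h i 0 * h j 0 * ((X^T *m X) i j - n%:R *+ (i == j))| <=
    n%:R * eta * (((q i) * (j \in A)%:R + (q j) * (i \in A)%:R) / 2).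
  rewrite normrM mulrC; case: (boolP (i \in A)) => iA; last first.
    rewrite hA// mul0r normr0 /q hA// expr0n/= !(mul0r, mulr0) addr0.
    by rewrite mul0r mulr0.
  case: (boolP (j \in A)) => jA; last first.
    rewrite (hA _ jA) mulr0 normr0 /q (hA _ jA) expr0n/= !(mul0r, mulr0) addr0.
    by rewrite mul0r mulr0.
  apply: ler_pM => //; rewrite !mulr1 /q ler_norml.
  have := sqr_ge0 (h i 0 - h j 0); have := sqr_ge0 (h i 0 + h j 0).
  rewrite !expr2; nra.
apply: le_trans (ler_norm_sum _ _ _) _.
apply: (@le_trans _ _ (\sum_i \sum_j
   n%:R * eta * (((q i) * (j \in A)%:R + (q j) * (i \in A)%:R) / 2))).
  apply: ler_sum => i _; apply: le_trans (ler_norm_sum _ _ _) _.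
  by apply: ler_sum => j _; exact: le1.
under eq_bigr => i _.
  rewrite -mulr_sumr -mulr_suml big_split/= -mulr_sumr -mulr_suml sum_mem_card.
  rewrite -[\sum_i0 q i0]sqnormE.
  over.
rewrite -mulr_sumr -mulr_suml big_split/= -mulr_suml -mulr_sumr sum_mem_card.
rewrite -[\sum_i0 q i0]sqnormE.
by rewrite le_eqVlt; apply/orP; left; apply/eqP; field.
Qed.

End squared_norm.

(** * Residual sums of squares *)

Section least_squares.
Context {R : realType} {n p : nat}.
Implicit Types (X : 'M[R]_(n, p)) (Y : 'cV[R]_n) (D : {set 'I_p}).

(* [sel D *m v] is the vector that carries the entries of [v] at the indices
   of [D] and vanishes elsewhere. *)
Let sel D : 'M[R]_(p, #|D|) := subdesign 1%:M D.

Let subdesignE X D : subdesign X D = X *m sel D.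
Proof.
apply/matrixP => i j; rewrite !mxE (bigD1 (enum_val j))//= big1.
  by rewrite addr0 !mxE eqxx mulr1.
by move=> k /negbTE kj; rewrite !mxE kj mulr0.
Qed.

Let selE D (v : 'cV[R]_#|D|) j : j \notin D -> (sel D *m v) j 0 = 0.
Proof.
move=> jD; rewrite mxE big1// => i _; rewrite !mxE; case: eqVneq => [ji|_].
  by move: jD; rewrite ji enum_valP.
by rewrite mul0r.
Qed.

Let selK D (b : 'cV[R]_p) : (forall j, j \notin D -> b j 0 = 0) ->
  sel D *m ((sel D)^T *m b) = b.
Proof.
move=> bD; have E (i : 'I_#|D|) : ((sel D)^T *m b) i 0 = b (enum_val i) 0.
  rewrite mxE (bigD1 (enum_val i))//= big1 ?addr0 ?mxE ?mxE ?eqxx ?mul1r//.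
  by move=> k /negbTE kj; rewrite !mxE kj mul0r.
apply/matrixP => j k; rewrite ord1; case: (boolP (j \in D)) => jD; last first.
  by rewrite selE// bD.
rewrite mxE (bigD1 (enum_rank_in jD j))//= E !mxE enum_rankK_in// eqxx mul1r.
rewrite big1 ?addr0// => i ij; rewrite !mxE.
case: eqVneq => [ji|]; last by rewrite mul0r.
have ii := enum_valK_in jD i; rewrite -ji in ii.
by rewrite ii eqxx in ij.
Qed.

Let gram X D := (subdesign X D)^T *m subdesign X D.

(** The inverse inside [Defs.proj] is a genuine one as soon as X is injective
    on the vectors that live on D. *)
Lemma gram_unit X D :
  (forall h : 'cV[R]_p, (forall j, j \notin D -> h j 0 = 0) ->
    sqnorm (X *m h) <= 0 -> h = 0) ->
  gram X D \in unitmx.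
Proof.
move=> inj; rewrite -row_free_unit; apply: inj_row_free => v vG.
have h0 : sel D *m v^T = 0.
  apply: inj => [j jD|]; first exact: selE.
  rewrite mulmxA -subdesignE /sqnorm trmx_mul trmxK -mulmxA (mulmxA _^T).
  by rewrite mulmxA vG mul0mx mxE.
have : v^T = 0; last by move/(congr1 trmx); rewrite trmxK trmx0.
apply/matrixP => i j; rewrite ord1.
have := congr1 (fun M : 'cV[R]_p => M (enum_val i) 0) h0.
rewrite mxE (bigD1 i)//= big1 ?addr0.
  by rewrite !mxE eqxx mul1r.
move=> k ki; rewrite !mxE.
case: eqVneq => [/enum_val_inj ik|]; last by rewrite mul0r.
by rewrite ik eqxx in ki.
Qed.

Section gram_unit.
Variables (X : 'M[R]_(n, p)) (D : {set 'I_p}).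
Hypothesis GU : gram X D \in unitmx.

Let projT : (Defs.proj X D)^T = Defs.proj X D.
Proof.
rewrite /Defs.proj -/(gram X D) !trmx_mul trmxK trmx_inv -mulmxA.
by have -> : (gram X D)^T = gram X D by rewrite /gram trmx_mul trmxK.
Qed.

Let proj_sub : Defs.proj X D *m subdesign X D = subdesign X D.
Proof. by rewrite /Defs.proj -!mulmxA -/(gram X D) mulVmx// mulmx1. Qed.

Let proj_idem : Defs.proj X D *m Defs.proj X D = Defs.proj X D.
Proof.
rewrite {2}/Defs.proj -[X in _ *m X]mulmxA mulmxA proj_sub.
by rewrite mulmxA.
Qed.

Let rssE Y : n%:R * rss X Y D = sqnorm (Y - Defs.proj X D *m Y) \/ n = 0%N.
Proof.
case: (eqVneq n 0%N) => [|n0]; [by right|left].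
rewrite /rss mulrA divff ?pnatr_eq0// mul1r /sqnorm.
have -> : Y - Defs.proj X D *m Y = (1%:M - Defs.proj X D) *m Y.
  by rewrite mulmxBl mul1mx.
have -> : ((1%:M - Defs.proj X D) *m Y)^T = Y^T *m (1%:M - Defs.proj X D).
  by rewrite trmx_mul [(_ - _)^T]linearB/= trmx1 projT.
have PP : (1%:M - Defs.proj X D) *m (1%:M - Defs.proj X D) =
    1%:M - Defs.proj X D.
  by rewrite mulmxBr mulmx1 mulmxBl mul1mx proj_idem subrr subr0.
by rewrite !mulmxA -(mulmxA _ _ (1%:M - _)) PP.
Qed.

(** With [rss_min] below, [n%:R * rss X Y D] is the least squared distance from
    Y to the span of the columns in D. The attained value serves for lower
    bounds on competitors of the support, the minimality for an upper bound on
    the support itself. *)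
Lemma rss_attained Y : (0 < n)%N ->
  exists2 b : 'cV[R]_p, (forall j, j \notin D -> b j 0 = 0) &
    n%:R * rss X Y D = sqnorm (Y - X *m b).
Proof.
move=> n0; exists (sel D *m (invmx (gram X D) *m ((subdesign X D)^T *m Y))).
  by move=> j; exact: selE.
case: (rssE Y) => [->|n00]; last by rewrite n00 in n0.
by rewrite mulmxA -subdesignE /Defs.proj !mulmxA.
Qed.

Lemma rss_min Y (b : 'cV[R]_p) : (0 < n)%N ->
  (forall j, j \notin D -> b j 0 = 0) ->
  n%:R * rss X Y D <= sqnorm (Y - X *m b).
Proof.
move=> n0 bD; case: (rssE Y) => [->|n00]; last by rewrite n00 in n0.
have Xb : Defs.proj X D *m (X *m b) = X *m b.
  by rewrite -(selK bD) (mulmxA X) -subdesignE mulmxA proj_sub.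
set u := Y - X *m b.
have -> : Y - Defs.proj X D *m Y = u - Defs.proj X D *m u.
  rewrite /u mulmxBr Xb; apply/matrixP => i j; rewrite !mxE; ring.
rewrite sqnormB projT.
have -> : \sum_j (Defs.proj X D *m u) j 0 * u j 0 = sqnorm (Defs.proj X D *m u).
  rewrite [RHS]/sqnorm trmx_mul projT -(mulmxA u^T) (mulmxA (Defs.proj X D)).
  rewrite proj_idem.
  by rewrite [RHS]mxE; apply: eq_bigr => j _; rewrite [u^T _ _]mxE mulrC.
have := sqnorm_ge0 (Defs.proj X D *m u); lra.
Qed.

End gram_unit.
End least_squares.

(** * Separation of the support from its competitors *)

Section separation.
Context {R : realType}.

Lemma quadratic_min (A z h : R) : 0 < A ->
  - (z ^+ 2 / A) <= A * h ^+ 2 - 2 * z * h.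
Proof.
move=> A0; rewrite -subr_ge0.
have -> : A * h ^+ 2 - 2 * z * h - - (z ^+ 2 / A) = (A * h - z) ^+ 2 / A.
  by field; rewrite gt_eqF.
by rewrite divr_ge0 ?sqr_ge0 ?ltW.
Qed.

(** Here [kappa] bounds all relative errors, and [kappa * (4 * r + 10) <= r - 1]
    leaves room for their sum: an index of the support missed by [D] costs at
    least [(1 - 2 * kappa) * (2 * r * L) - kappa * L], a wrong index gains at
    most [2 * L * (1 + 4 * kappa)], and the common indices together gain at
    most [kappa * L]. In place of the optimal fit on the support, the proof
    uses one that is optimal up to the incoherence of the design. *)
Lemma support_beats_subset n p (X : 'M[R]_(n, p)) (b : 'cV[R]_p) (e : 'cV[R]_n)
    (s : nat) (kappa eta L r a : R) (D : {set 'I_p}) :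
  (0 < n)%N -> 0 < L -> 0 < kappa -> kappa <= 1 / 4 ->
  kappa * (4 * r + 10) <= r - 1 -> 1 < r ->
  0 < a -> n%:R * a ^+ 2 = 2 * r * L ->
  2 * s%:R ^+ 2 * eta <= kappa -> signal_class s a b ->
  (forall i j, `|(X^T *m X) i j - n%:R *+ (i == j)| <= n%:R * eta) ->
  (forall j, j \notin supp b ->
    (X^T *m e) j 0 ^+ 2 <= n%:R * (2 * (1 + kappa) * L)) ->
  (forall j, j \in supp b ->
    (X^T *m e) j 0 ^+ 2 <= n%:R * (kappa ^+ 2 * L)) ->
  #|D| = s -> D != supp b ->
  rss X (X *m b + e) (supp b) < rss X (X *m b + e) D.
Proof.
move=> n_gt0 L_gt0 kappa_gt0 kappa_le kappa_r r_gt1 a_gt0 aE eta_s b_class coh.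
move=> z_off z_on cD DS; set z := X^T *m e in z_off z_on.
have [N NE] : exists N : R, N = n%:R by exists n%:R.
have [eps epsE] : exists eps : R, eps = 2 * s%:R * eta by eexists.
have N_gt0 : 0 < N by rewrite NE ltr0n.
have [cS bS] := b_class; set S := supp b in DS cS bS *.
pose t := #|S :\: D|.
have tE : #|D :\: S| = t.
  apply/eqP; rewrite -(eqn_add2l #|D :&: S|) cardsID cD.
  by rewrite finset.setIC /t -cS cardsID.
have t_gt0 : (0 < t)%N.
  rewrite lt0n cards_eq0 finset.setD_eq0; apply/negP => SD.
  by move: DS; rewrite eq_sym eqEcard SD cD cS leqnn.
have s_gt0 : (0 < s)%N.
  by rewrite -cS (leq_trans t_gt0)// subset_leq_card// finset.subsetDl.
have s1 : 1 <= s%:R :> R by rewrite ler1n.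
have [j0 _] : exists j : 'I_p, true.
  by move: t_gt0; rewrite card_gt0 => /set0Pn[j _]; exists j.
have eta0 : 0 <= eta.
  by have := le_trans (normr_ge0 _) (coh j0 j0); rewrite -NE pmulr_rge0.
have eps0 : 0 <= eps by rewrite epsE; nra.
have seps : s%:R * eps <= kappa by apply: le_trans eta_s; rewrite epsE; nra.
have epsk : eps <= kappa by nra.
(* both fits move the coefficients only on a set of at most 2s indices *)
have norm_near (h : 'cV[R]_p) : (forall j, j \notin D :|: S -> h j 0 = 0) ->
    `|sqnorm (X *m h) - N * sqnorm h| <= N * eps * sqnorm h.
  move=> hA; rewrite NE; apply: le_trans (coherence_sqnorm coh hA) _.
  rewrite ler_wpM2r ?sqnorm_ge0// epsE -NE -mulrA ler_pM2l// mulrC ler_wpM2r//.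
  rewrite -natrM ler_nat mul2n -addnn -{1}cD -cS.
  by rewrite cardsU leq_subr.
have unit_sub (A : {set 'I_p}) : A \subset D :|: S ->
    (subdesign X A)^T *m subdesign X A \in unitmx.
  move=> /fintype.subsetP AD; apply: gram_unit => h hA Xh; apply: sqnorm_eq0.
  have /norm_near : forall j, j \notin D :|: S -> h j 0 = 0.
    by move=> j /(contra (AD j)); exact: hA.
  rewrite ler_norml => /andP[+ _].
  have := sqnorm_ge0 h; have : 0 < 1 - eps by lra.
  set q := sqnorm h; set w := sqnorm _ in Xh * => e1 q0 h1.
  have : N * (1 - eps) * q <= 0 by nra.
  by rewrite pmulr_rle0// mulr_gt0.
have [bD bD0 rssD] :=
  rss_attained (unit_sub _ (finset.subsetUl D S)) (X *m b + e) n_gt0.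
pose h := bD - b.
(* the minimizer of the decoupled quadratics N (1 + eps) x^2 - 2 z_j x, used
   only at the common indices *)
pose h' : 'cV[R]_p :=
  \col_j (if j \in S :&: D then z j 0 / (N * (1 + eps)) else 0).
have b0 j : j \notin S -> b j 0 = 0 by rewrite inE negbK => /eqP.
have rssS : N * rss X (X *m b + e) S <= sqnorm (X *m b + e - X *m (b + h')).
  rewrite NE; apply: rss_min => //; first exact: unit_sub (finset.subsetUr _ _).
  by move=> j jS; rewrite !mxE b0// inE (negbTE jS) addr0.
have EE : X *m b + e - X *m (b + h') = e - X *m h'.
  by rewrite mulmxDr opprD addrACA subrr add0r.
have EE' : X *m b + e - X *m bD = e - X *m h.
  by rewrite /h mulmxBr opprB addrC addrA addrAC addrA -addrA addrC.
rewrite -subr_gt0 -(pmulr_rgt0 _ N_gt0) mulrBr.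
rewrite EE sqnormB -/z in rssS; rewrite -NE EE' sqnormB -/z in rssD.
have /norm_near : forall j, j \notin D :|: S -> h' j 0 = 0.
  by move=> j; rewrite !mxE !inE negb_or => /andP[/negbTE -> /negbTE ->].
rewrite ler_norml => /andP[_ nh'].
have /norm_near : forall j, j \notin D :|: S -> h j 0 = 0.
  move=> j; rewrite inE negb_or => /andP[jD jS].
  by rewrite !mxE bD0// b0// subrr.
rewrite ler_norml => /andP[nh _].
pose f j := N * (1 - eps) * h j 0 ^+ 2 - 2 * z j 0 * h j 0 -
  (N * (1 + eps) * h' j 0 ^+ 2 - 2 * z j 0 * h' j 0).
suff f_gt0 : 0 < \sum_j f j.
  have fE : \sum_j f j = N * (1 - eps) * sqnorm h - 2 * \sum_j z j 0 * h j 0 -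
      (N * (1 + eps) * sqnorm h' - 2 * \sum_j z j 0 * h' j 0).
    rewrite !sqnormE !mulr_sumr -!sumrB; apply: eq_bigr => j _.
    by rewrite /f; ring.
  by rewrite rssD; lra.
pose c1 := (1 - 2 * kappa) * (2 * r * L) - kappa * L.
pose c2 := 2 * L * (1 + 4 * kappa).
pose c3 := 4 * eps * kappa ^+ 2 * L.
have fge j : c1 * (j \in S :\: D)%:R - c2 * (j \in D :\: S)%:R -
    c3 * (j \in S :&: D)%:R <= f j.
  rewrite /f; case: (boolP (j \in S)) => jS; case: (boolP (j \in D)) => jD;
    rewrite [h' j 0]mxE !finset.in_setI !finset.in_setD
      ?jS ?(negbTE jS) ?jD ?(negbTE jD)/=
      ?mulr1 ?mulr0 ?subr0 ?expr0n/= ?mulr0 ?add0r ?addr0 ?sub0r.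
  - have zj := z_on _ jS; set zz := z j 0 in zj *; set hh := h j 0.
    have := @quadratic_min (N * (1 - eps)) zz hh.
    rewrite mulr_gt0//; last lra.
    move=> /(_ isT) le1.
    have -> : N * (1 + eps) * (zz / (N * (1 + eps))) ^+ 2 -
        2 * zz * (zz / (N * (1 + eps))) = - (zz ^+ 2 / (N * (1 + eps))).
      by field; rewrite (gt_eqF N_gt0) gt_eqF//; lra.
    have zN : zz ^+ 2 / N <= kappa ^+ 2 * L by rewrite ler_pdivrMr// mulrC NE.
    have E : zz ^+ 2 / (N * (1 - eps)) - zz ^+ 2 / (N * (1 + eps)) =
       zz ^+ 2 / N * (2 * eps / (1 - eps ^+ 2)).
      have : 1 - eps ^+ 2 != 0 by rewrite gt_eqF//; nra.
      have : 1 - eps != 0 by rewrite gt_eqF//; lra.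
      have : 1 + eps != 0 by rewrite gt_eqF//; lra.
      by move=> h1 h2 h3; field; rewrite h1 h2 h3 (gt_eqF N_gt0).
    have e4 : 2 * eps / (1 - eps ^+ 2) <= 4 * eps.
      rewrite ler_pdivrMr; nra.
    have e5 : 0 <= zz ^+ 2 / N by rewrite divr_ge0 ?sqr_ge0 ?ltW.
    have : zz ^+ 2 / N * (2 * eps / (1 - eps ^+ 2)) <=
        kappa ^+ 2 * L * (4 * eps).
      apply: ler_pM => //; rewrite divr_ge0//; nra.
    rewrite -E /c3; lra.
  - have zj := z_on _ jS; set zz := z j 0 in zj *.
    have -> : h j 0 = - b j 0 by rewrite !mxE bD0// sub0r.
    set bb := b j 0.
    have ab : a ^+ 2 <= bb ^+ 2.
      rewrite -[bb ^+ 2]real_normK ?num_real// ler_sqr ?nnegrE//.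
        exact: bS.
      exact: ltW.
    have := @quadratic_min (N * kappa) (- zz) bb.
    rewrite mulr_gt0// => /(_ isT); rewrite sqrrN => le1.
    have zN : zz ^+ 2 / (N * kappa) <= kappa * L.
      rewrite ler_pdivrMr ?mulr_gt0// NE; apply: le_trans zj _.
      by rewrite le_eqVlt; apply/orP; left; apply/eqP; ring.
    have aN : N * a ^+ 2 = 2 * r * L by rewrite NE.
    have : N * (1 - 2 * kappa) * a ^+ 2 <= N * (1 - eps - kappa) * bb ^+ 2.
      apply: ler_pM; rewrite ?sqr_ge0//; first by rewrite mulr_ge0 ?ltW//; lra.
      by rewrite ler_pM2l//; lra.
    rewrite /c1 sqrrN; nra.
  - have zj := z_off _ jS; set zz := z j 0 in zj *; set hh := h j 0.
    have := @quadratic_min (N * (1 - eps)) zz hh.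
    rewrite mulr_gt0//; last lra.
    move=> /(_ isT) le1.
    suff : zz ^+ 2 / (N * (1 - eps)) <= c2 by lra.
    rewrite ler_pdivrMr ?mulr_gt0//; last lra.
    apply: le_trans zj _; rewrite -NE /c2.
    have -> : 2 * L * (1 + 4 * kappa) * (N * (1 - eps)) =
      N * (2 * ((1 + 4 * kappa) * (1 - eps)) * L) by ring.
    rewrite ler_pM2l// ler_pM2r// ler_pM2l//; nra.
  - have -> : h j 0 = 0 by rewrite !mxE bD0// (b0 _ jS) subrr.
    by rewrite expr0n/= !mulr0 subr0 ?oppr0 ?lexx.
have : 0 < t%:R * (c1 - c2) - s%:R * c3.
  have t1 : 1 <= t%:R :> R by rewrite ler1n.
  have c3k : s%:R * c3 <= kappa * L.
    have -> : s%:R * c3 = (s%:R * eps) * (4 * kappa ^+ 2 * L).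
      by rewrite /c3; ring.
    have : 4 * kappa ^+ 2 * L <= L.
      rewrite -[leRHS]mul1r ler_pM2r//; nra.
    have : 0 <= 4 * kappa ^+ 2 * L by rewrite !mulr_ge0// ltW.
    have : 0 <= s%:R * eps by rewrite mulr_ge0.
    nra.
  have c12 : c1 - c2 - kappa * L = (2 * (r - 1) - kappa * (4 * r + 10)) * L.
    by rewrite /c1 /c2; ring.
  have : 0 < (2 * (r - 1) - kappa * (4 * r + 10)) * L.
    by rewrite mulr_gt0//; lra.
  rewrite -c12 => c12p.
  have kL : 0 < kappa * L by rewrite mulr_gt0.
  have : 1 * (c1 - c2) <= t%:R * (c1 - c2) by rewrite ler_wpM2r//; lra.
  lra.
move=> /lt_le_trans; apply.
apply: (@le_trans _ _ (\sum_j (c1 * (j \in S :\: D)%:R -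
    c2 * (j \in D :\: S)%:R - c3 * (j \in S :&: D)%:R))); last first.
  by apply: ler_sum => j _.
rewrite !sumrB -!mulr_sumr !sum_mem_card tE -/t.
have : #|S :&: D|%:R <= s%:R :> R.
  by rewrite ler_nat -cS subset_leq_card// finset.subsetIl.
have : 0 <= c3 by rewrite /c3 !mulr_ge0// ltW.
nra.
Qed.

End separation.

(** * Weighted images of measures *)

Section weighted_law.
Local Open Scope ereal_scope.
Context d d' (T : measurableType d) (T' : measurableType d') (R : realType).
Variables (mu : {measure set T -> \bar R}) (mu' : {measure set T' -> \bar R}).
Variables (phi : T -> T') (mphi : measurable_fun setT phi).
Variables (W : T -> R) (mW : measurable_fun setT W).
Hypothesis W0 : forall x, (0 <= W x)%R.
Hypothesis law :
  forall A, measurable A -> \int[mu]_(x in phi @^-1` A) (W x)%:E = mu' A.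

Import HBNNSimple.

Let weighted_nnsfun (g : {nnsfun T' >-> R}) :
  \int[mu]_x ((W x)%:E * (g (phi x))%:E) = \int[mu']_y (g y)%:E.
Proof.
have mpre A : measurable A -> measurable (phi @^-1` A).
  by move=> mA; rewrite -[_ @^-1` _]setTI; exact: mphi.
rewrite -[RHS]/(\int[mu']_y (EFin \o g) y) integralT_nnsfun sintegralE.
transitivity (\int[mu]_x \sum_(r \in range g)
    ((W x)%:E * (r * \1_(phi @^-1` (g @^-1` [set r])) x)%:E)).
  apply: eq_integral => x _; rewrite {1}(fimfunE g) -fsumEFin//.
  rewrite ge0_mule_fsumr//.
  by move=> r; rewrite lee_fin; exact: nnfun_muleindic_ge0.
rewrite ge0_integral_fsum//.
- apply: eq_fsbigr => r _.
  have [r0|r0] := ltP r 0%R.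
    have -> : g @^-1` [set r] = set0.
      by rewrite preimage_nnfun0.
    rewrite measure0 mule0 integral0_eq// => x _.
    by rewrite preimage_set0 indic0 mulr0 mule0.
  rewrite -law//.
  transitivity (\int[mu]_x
      (r%:E * ((W x)%:E * (\1_(phi @^-1` (g @^-1` [set r])) x)%:E))).
    by apply: eq_integral => x _; rewrite EFinM muleCA.
  rewrite ge0_integralZl//; first last.
  - by move=> x _; rewrite mule_ge0// ?lee_fin.
  - apply: emeasurable_funM; first exact/measurable_EFinP.
    by apply/measurable_EFinP/measurable_indic; exact: mpre.
  congr (_ * _); rewrite [RHS]integral_mkcond; apply: eq_integral => x _.
  by rewrite epatch_indic.
- move=> r; apply: emeasurable_funM; first exact/measurable_EFinP.
  apply/measurable_EFinP.
  by apply: measurable_funM => //; apply/measurable_indic; exact: mpre.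
- move=> r x _; rewrite mule_ge0 ?lee_fin//.
  exact: (nnfun_muleindic_ge0 g r (phi x)).
Qed.

(** Integration against the image by [phi] of the measure of density [W]; for
    [W = 1] it is the change of variables for pushforward measures. *)
Lemma ge0_integral_weighted (f : T' -> \bar R) : measurable_fun setT f ->
  (forall y, 0 <= f y) -> \int[mu]_x ((W x)%:E * f (phi x)) = \int[mu']_y f y.
Proof.
move=> mf f0; pose f_ := nnsfun_approx measurableT mf.
have cf y : (f_ n y)%:E @[n --> \oo] --> f y by exact: cvg_nnsfun_approx.
transitivity (limn (fun n => \int[mu']_y (f_ n y)%:E)); last first.
  rewrite -monotone_convergence//.
  - by apply: eq_integral => y _; apply/cvg_lim.
  - by move=> n; exact/measurable_EFinP/measurable_funP.
  - by move=> n y _; rewrite lee_fin.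
  - by move=> y _ m n mn; rewrite lee_fin; exact/lefP/nd_nnsfun_approx.
have -> : (fun n => \int[mu']_y (f_ n y)%:E) =
    (fun n => \int[mu]_x ((W x)%:E * (f_ n (phi x))%:E)).
  by apply/funext => n; rewrite weighted_nnsfun.
rewrite -monotone_convergence//.
- apply: eq_integral => x _; apply/esym/cvg_lim => //.
  exact/cvgeZl.
- move=> n; apply: emeasurable_funM; first exact/measurable_EFinP.
  apply/measurable_EFinP; exact: measurableT_comp.
- by move=> n y _; rewrite mule_ge0// ?lee_fin.
- move=> y _ m n mn; rewrite lee_wpmul2l ?lee_fin//.
  exact/lefP/nd_nnsfun_approx.
Qed.

End weighted_law.

Section weighted_law_product.
Local Open Scope ereal_scope.
Context d d1 d2 (T : measurableType d) (T1 : measurableType d1)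
  (T2 : measurableType d2) (R : realType).
Variables (mu : {measure set T -> \bar R}).
Variables (nu1 : probability T1 R) (nu2 : probability T2 R).
Variables (phi : T -> T1 * T2) (mphi : measurable_fun setT phi).
Variables (W : T -> R) (mW : measurable_fun setT W).
Hypothesis W0 : forall x, (0 <= W x)%R.

(** Boxes form a generating family stable under intersection, so the image of a
    weighted measure is determined by its values on them. *)
Lemma ge0_integral_weighted_product (c : {nonneg R}) (g : T1 * T2 -> \bar R) :
  (forall A B, measurable A -> measurable B ->
    \int[mu]_(x in phi @^-1` (A `*` B)) (W x)%:E =
    c%:num%:E * (nu1 A * nu2 B)) ->
  measurable_fun setT g -> (forall y, 0 <= g y) ->
  \int[mu]_x ((W x)%:E * g (phi x)) = c%:num%:E * \int[nu1 \x nu2]_y g y.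
Proof.
move=> boxE mg g0.
pose m (C : set (T1 * T2)) := \int[mu]_(x in phi @^-1` C) (W x)%:E.
have mpre C : measurable C -> measurable (phi @^-1` C).
  by move=> mC; rewrite -[_ @^-1` _]setTI; exact: mphi.
have m0 : m set0 = 0 by rewrite /m preimage_set0 integral_set0.
have mge0 C : 0 <= m C by apply: integral_ge0 => x _; rewrite lee_fin.
have madd : semi_sigma_additive m.
  move=> F mF tF mUF; rewrite /m preimage_bigcup ge0_integral_bigcup//.
  - apply: is_cvg_ereal_nneg_natsum => k _.
    by apply: integral_ge0 => x _; rewrite lee_fin.
  - by move=> k; exact: mpre.
  - by apply/measurable_EFinP; exact: measurable_funTS.
  - by move=> x _; rewrite lee_fin.
  - apply/trivIsetP => i j _ _ ij; rewrite -preimage_setI.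
    by move/trivIsetP : tF => /(_ _ _ _ _ ij) ->//; rewrite preimage_set0.
pose mm : {measure set (T1 * T2) -> \bar R} :=
  HB.pack m (isMeasure.Build _ _ _ m m0 mge0 madd).
have E C : measurable C -> m C = mscale c (nu1 \x nu2) C.
  move=> mC.
  pose G := [set A `*` B | A in @measurable _ T1 & B in @measurable _ T2].
  have boxm A B : measurable A -> measurable B ->
      mm (A `*` B) = mscale c (nu1 \x nu2) (A `*` B).
    by move=> mA mB; rewrite /mm/= /m boxE// /mscale/= product_measure1E.
  rewrite -[m]/(mm : _ -> _).
  apply: (measure_unique G (fun=> setT)) => //.
  - by rewrite measurable_prod_measurableType.
  - move=> _ _ [A1 mA1 [B1 mB1 <-]] [A2 mA2 [B2 mB2 <-]]; rewrite -setXI.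
    exists (A1 `&` A2); first exact: measurableI.
    by exists (B1 `&` B2) => //; exact: measurableI.
  - by move=> n; exists setT => //; exists setT => //; rewrite setXTT.
  - by rewrite bigcup_const//; exists 0%N.
  - by move=> _ [A mA [B mB <-]]; exact: boxm.
  - move=> _; rewrite -setXTT boxm// /mscale/= product_measure1E//.
    apply: (@le_lt_trans _ _ (c%:num%:E * (1 * 1))); last first.
      by rewrite !mule1 ltry.
    by rewrite !lee_pmul ?mule_ge0 ?lee_fin ?probability_le1.
rewrite (ge0_integral_weighted mphi mW W0 (mu' := mscale c (nu1 \x nu2))) => //.
by rewrite ge0_integral_mscale.
Qed.

End weighted_law_product.

(** * Expectations of products over independent pairs *)

Section independent_pairs.
Local Open Scope ereal_scope.
Context d d1 d2 (T : measurableType d) (T1 : measurableType d1)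
  (T2 : measurableType d2) (R : realType).
Variables (P : probability T R).
Variables (nu1 : probability T1 R) (nu2 : probability T2 R).

(** The [U i] and [V i] are mutually independent with laws [nu1] and [nu2].
    Taking the whole space for some of the sets gives the product rule for
    subfamilies. *)
Definition iid_pairs (n : nat) (U : 'I_n -> T -> T1) (V : 'I_n -> T -> T2) :=
  forall (A : 'I_n -> set T1) (B : 'I_n -> set T2),
    (forall i, measurable (A i)) -> (forall i, measurable (B i)) ->
    P (\bigcap_i (U i @^-1` A i `&` V i @^-1` B i)) =
    \prod_(i < n) (nu1 (A i) * nu2 (B i)).

Lemma indic_setX (A : set T1) (B : set T2) u v :
  \1_(A `*` B) (u, v) = (\1_A u * \1_B v)%R :> R.
Proof.
rewrite !indicE -natrM mulnb; congr ((nat_of_bool _)%:R); apply/idP/andP.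
  by rewrite !inE => -[].
by rewrite !inE.
Qed.

(** The product rule is an instance of the claim for indicators of boxes. These
    are replaced by [g] one index at a time: the factors at the other indices
    act as a weight, under which the law of one pair is a multiple of the
    product measure by [ge0_integral_weighted_product]. *)
Lemma expectation_prod_pairs n (U : 'I_n -> T -> T1) (V : 'I_n -> T -> T2)
    (g : T1 * T2 -> R) (c : R) :
  iid_pairs U V ->
  (forall i, measurable_fun setT (U i)) ->
  (forall i, measurable_fun setT (V i)) ->
  measurable_fun setT g -> (forall y, (0 <= g y)%R) ->
  \int[nu1 \x nu2]_y (g y)%:E = c%:E ->
  \int[P]_x (\prod_(i < n) g (U i x, V i x))%:E = (c ^+ n)%:E.
Proof.
move=> indep mU mV mg g0 gc.
have c0 : (0 <= c)%R.
  by rewrite -lee_fin -gc; apply: integral_ge0 => y _; rewrite lee_fin.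
pose F k (A : 'I_n -> set T1) (B : 'I_n -> set T2) (i : 'I_n) x : R :=
  if (i < k)%N then g (U i x, V i x)
  else (\1_(A i) (U i x) * \1_(B i) (V i x))%R.
pose G k (A : 'I_n -> set T1) (B : 'I_n -> set T2) (i : 'I_n) : R :=
  if (i < k)%N then c else (fine (nu1 (A i)) * fine (nu2 (B i)))%R.
have mphi i : measurable_fun setT (fun x => (U i x, V i x)).
  exact: measurable_fun_pair.
have mF k A B i : measurable (A i) -> measurable (B i) ->
    measurable_fun setT (F k A B i).
  move=> mA mB; rewrite /F; case: (i < k)%N; first exact: measurableT_comp.
  apply: measurable_funM; apply: measurableT_comp => //;
  exact: measurable_indic.
have F0 k A B i x : (0 <= F k A B i x)%R.
  by rewrite /F; case: ifP => // _; rewrite mulr_ge0.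
have G0 k A B i : (0 <= G k A B i)%R.
  by rewrite /G; case: ifP => // _; rewrite mulr_ge0 ?fine_ge0.
have key k : (k <= n)%N -> forall A B,
    (forall i, measurable (A i)) -> (forall i, measurable (B i)) ->
    \int[P]_x (\prod_(i < n) F k A B i x)%:E = (\prod_(i < n) G k A B i)%:E.
  elim: k => [_ A B mA mB|k IH kn A B mA mB].
    pose E := \bigcap_i (U i @^-1` A i `&` V i @^-1` B i).
    have mE : measurable E.
      apply: fin_bigcap_measurable => // i _; apply: measurableI.
        by rewrite -[_ @^-1` _]setTI; exact: mU.
      by rewrite -[_ @^-1` _]setTI; exact: mV.
    transitivity (\int[P]_x (\1_E x)%:E).
      apply: eq_integral => x _; congr EFin; rewrite /F/=.
      rewrite indicE; have [xE|xE] := pselect (E x).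
        rewrite mem_set// big1// => i _; have [xU xV] := xE i I.
        by rewrite !indicE !mem_set// mulr1.
      rewrite memNset//; move/asboolPn : xE => /existsp_asboolPn[i].
      move=> /not_implyP[_] /not_andP xi; rewrite (bigD1 i)//= !indicE.
      case: xi => xi.
        by rewrite (@memNset _ (A i) (U i x) xi) !mul0r.
      by rewrite (@memNset _ (B i) (V i x) xi) mulr0 mul0r.
    transitivity (P E); first by rewrite integral_indic// setIT.
    rewrite /E indep// -prodEFin.
    by apply: eq_bigr => i _; rewrite /G EFinM !fineK ?fin_num_measure.
  pose i0 := Ordinal kn.
  pose W x := (\prod_(i < n | i != i0) F k A B i x)%R.
  have c'0 : (0 <= \prod_(i < n | i != i0) G k A B i)%R by exact: prodr_ge0.
  pose c' := NngNum c'0.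
  have E i : i != i0 -> (i < k.+1)%N = (i < k)%N.
    by move=> ii; rewrite ltnS leq_eqVlt -[i == k :> nat]/(i == i0) (negbTE ii).
  transitivity (\int[P]_x ((W x)%:E * (g (U i0 x, V i0 x))%:E)).
    apply: eq_integral => x _; rewrite -EFinM; congr EFin.
    rewrite (bigD1 i0)//= mulrC; congr (_ * _)%R; last by rewrite /F/= ltnSn.
    by apply: eq_bigr => i ii; rewrite /F E.
  rewrite (@ge0_integral_weighted_product _ _ _ _ _ _ _ P nu1 nu2 _ (mphi i0)
    W _ _ c' (EFin \o g)) //.
  - rewrite gc -EFinM; congr EFin; rewrite [RHS](bigD1 i0)//= mulrC.
    rewrite /G ltnSn; congr (_ * _)%R.
    by apply: eq_bigr => i ii; rewrite E.
  - have -> : W = (fun x =>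
        \prod_(i <- [seq j <- index_enum 'I_n | j != i0]) F k A B i x)%R.
      by apply/funext => x; rewrite /W big_filter.
    by apply: measurable_prod => i _; exact: mF.
  - by move=> x; exact: prodr_ge0.
  - move=> A0 B0 mA0 mB0.
    pose A' i := if i == i0 then A0 else A i.
    pose B' i := if i == i0 then B0 else B i.
    have := IH (ltnW kn) A' B'.
    move=> IH'.
    rewrite integral_mkcond.
    transitivity (\int[P]_x (\prod_(i < n) F k A' B' i x)%:E).
      apply: eq_integral => x _; rewrite (bigD1 i0)//= epatch_indic -EFinM.
      congr EFin; rewrite mulrC [F _ _ _ i0 _]/F ltnn /A' /B' eqxx.
      congr (_ * _)%R.
        by rewrite -[in RHS]indic_setX.
      by apply: eq_bigr => i ii; rewrite /F (negbTE ii).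
    rewrite IH'.
    + rewrite (bigD1 i0)//= {1}/G ltnn /A' /B' eqxx !EFinM.
      rewrite !fineK ?fin_num_measure//.
      rewrite muleC; congr (_%:E * _); apply: eq_bigr => i ii.
      by rewrite /G (negbTE ii).
    + by move=> i; rewrite /A'; case: (i == i0).
    + by move=> i; rewrite /B'; case: (i == i0).
  - exact/measurable_EFinP.
have -> : (c ^+ n = \prod_(i < n) G n (fun=> setT) (fun=> setT) i)%R.
  rewrite -[n in LHS]card_ord -prodr_const; apply: eq_bigr => i _.
  by rewrite /G ltn_ord.
rewrite -key//; apply: eq_integral => x _; congr EFin; apply: eq_bigr => i _.
by rewrite /F ltn_ord.
Qed.

End independent_pairs.

(** * Gaussian integrals *)

Section gaussian_integrals.
Context {R : realType}.
Local Notation mu := lebesgue_measure.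
Local Notation gamma := (@normal_prob R 0 1).

Lemma ge0_integral_normal_prob (f : R -> \bar R) : measurable_fun setT f ->
  (forall x, (0 <= f x)%E) ->
  (\int[gamma]_x f x = \int[mu]_x ((normal_pdf 0 1 x)%:E * f x))%E.
Proof.
move=> mf f0; apply/esym.
apply: (@ge0_integral_weighted _ _ _ _ _ mu gamma id _ (normal_pdf 0 1)) => //.
- exact: measurable_normal_pdf.
- exact: normal_pdf_ge0.
Qed.

(** Exponential tilting: if multiplication by [f] turns the standard normal
    density into [c] times another normal density, the expectation of [f] is
    [c], because densities integrate to 1. *)
Lemma ge0_integral_normal_tilt (f : R -> R) (c m s : R) :
  measurable_fun setT f ->
  (forall x, 0 <= f x) -> 0 <= c ->
  (forall x, normal_pdf 0 1 x * f x = c * normal_pdf m s x) ->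
  (\int[gamma]_x (f x)%:E = c%:E)%E.
Proof.
move=> mf f0 c0 fE.
rewrite ge0_integral_normal_prob//; last exact/measurable_EFinP.
under eq_integral do rewrite -EFinM fE EFinM.
rewrite ge0_integralZl_EFin//.
- by rewrite integral_normal_pdf mule1.
- by move=> x _; rewrite lee_fin normal_pdf_ge0.
- by apply/measurable_EFinP; exact: measurable_normal_pdf.
Qed.

Lemma normal_mgf (u : R) :
  (\int[gamma]_x (expR (u * x))%:E = (expR (u ^+ 2 / 2))%:E)%E.
Proof.
apply: (@ge0_integral_normal_tilt _ _ u 1).
- by apply: measurableT_comp => //; exact: measurable_funM.
- by move=> x; exact: expR_ge0.
- exact: expR_ge0.
- move=> x; rewrite !normal_pdfE ?oner_neq0//.
  rewrite -mulrA [RHS]mulrCA; congr (_ * _).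
  rewrite /normal_fun -!expRD; congr expR.
  by rewrite expr1n; field.
Qed.

Lemma normal_mgf_sqr (t : R) : 2 * t < 1 ->
  (\int[gamma]_x (expR (t * x ^+ 2))%:E = ((Num.sqrt (1 - 2 * t))^-1)%:E)%E.
Proof.
move=> t1; have t0 : 0 < 1 - 2 * t by lra.
set q := Num.sqrt (1 - 2 * t).
have q0 : 0 < q by rewrite sqrtr_gt0.
have q2 : q ^+ 2 = 1 - 2 * t by rewrite sqr_sqrtr// ltW.
apply: (@ge0_integral_normal_tilt _ _ 0 q^-1).
- by apply: measurableT_comp => //; apply: measurable_funM => //;
  exact: measurable_funX.
- by move=> x; exact: expR_ge0.
- by rewrite invr_ge0 ltW.
- move=> x; rewrite !normal_pdfE ?oner_neq0 ?invr_eq0 ?gt_eqF//.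
  rewrite -mulrA [RHS]mulrA; congr (_ * _).
    rewrite /normal_peak expr1n mul1r -mulrnAr.
    rewrite sqrtrM ?exprVn ?invr_ge0 ?sqr_ge0// sqrtrV ?sqr_ge0// sqrtr_sqr.
    rewrite gtr0_norm// invfM invrK mulrA mulVf ?mul1r//.
    by rewrite gt_eqF.
  rewrite /normal_fun -!expRD; congr expR.
  rewrite exprVn q2 expr1n -(mulr_natr _^-1) subr0; field.
  by rewrite gt_eqF.
Qed.

(** Integrating out the second variable leaves the expectation of
    [expR (l ^+ 2 / 2 * x ^+ 2)]. *)
Lemma normal_mgf_mul (l : R) : l ^+ 2 < 1 ->
  (\int[gamma \x gamma]_y (expR (l * (y.1 * y.2)))%:E =
   ((Num.sqrt (1 - l ^+ 2))^-1)%:E)%E.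
Proof.
move=> l1; rewrite fubini_tonelli1; last 2 first.
- apply/measurable_EFinP; apply: measurableT_comp => //.
  by apply: measurable_funM => //; exact: measurable_funM.
- by move=> x; rewrite lee_fin expR_ge0.
rewrite /fubini_F/=.
under eq_integral do under eq_integral do rewrite mulrA.
under eq_integral do rewrite normal_mgf.
have := @normal_mgf_sqr (l ^+ 2 / 2); rewrite mulrC divfK// => /(_ l1) <-.
by apply: eq_integral => x _; rewrite exprMn mulrAC.
Qed.

Lemma normal_mgf_fst (t : R) : 2 * t < 1 ->
  (\int[gamma \x gamma]_y (expR (t * (y.1 ^+ 2 - 1)))%:E =
   (expR (- t) / Num.sqrt (1 - 2 * t))%:E)%E.
Proof.
move=> t1; rewrite fubini_tonelli1; last 2 first.
- apply/measurable_EFinP; apply: measurableT_comp => //.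
  apply: measurable_funM => //; apply: measurable_funB => //.
  exact: measurable_funX.
- by move=> x; rewrite lee_fin expR_ge0.
rewrite /fubini_F/=.
transitivity (\int[gamma]_x ((expR (- t))%:E * (expR (t * x ^+ 2))%:E))%E.
  apply: eq_integral => x _.
  rewrite integral_cst// -EFinM -expRD mulrBr mulr1 addrC -[RHS]mule1.
  by congr (_ * _)%E; exact: probability_setT.
rewrite ge0_integralZl_EFin ?expR_ge0//.
- by rewrite normal_mgf_sqr.
- apply/measurable_EFinP; apply: measurableT_comp => //.
  by apply: measurable_funM => //; exact: measurable_funX.
Qed.

(** The square root of [(1 - y)^-1 = 1 + y / (1 - y) <= expR (y / (1 - y))]. *)
Lemma invr_sqrt_le_expR (y : R) : y < 1 ->
  (Num.sqrt (1 - y))^-1 <= expR (y / (2 * (1 - y))).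
Proof.
move=> y1; have y0 : 0 < 1 - y by lra.
rewrite -[leRHS]invrK lef_pV2 ?posrE ?sqrtr_gt0 ?invr_gt0 ?expR_gt0//.
rewrite -(@ler_pXn2r _ 2) ?nnegrE ?sqrtr_ge0 ?invr_ge0 ?expR_ge0//.
rewrite sqr_sqrtr ?(ltW y0)// exprVn -expRM_natl -[leRHS]invrK.
rewrite lef_pV2 ?posrE ?expR_gt0 ?invr_gt0//.
apply: le_trans (expR_ge1Dx _); rewrite le_eqVlt; apply/orP; left; apply/eqP.
by field; rewrite !gt_eqF.
Qed.

End gaussian_integrals.

(** * Chernoff bounds *)

Section tail_bounds.
Context d (T : measurableType d) (R : realType) (P : probability T R).
Local Notation gamma := (@normal_prob R 0 1).
Variables (n : nat) (U V : 'I_n -> T -> R).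
Hypothesis indep : iid_pairs P gamma gamma U V.
Hypothesis mU : forall i, measurable_fun setT (U i).
Hypothesis mV : forall i, measurable_fun setT (V i).

Let measurable_sum_pairs (h : R * R -> R) : measurable_fun setT h ->
  measurable_fun setT (fun x => \sum_(i < n) h (U i x, V i x)).
Proof.
move=> mh; apply: measurable_sum => i; apply: measurableT_comp => //.
exact: measurable_fun_pair.
Qed.

Let measurable_level (f : T -> R) (t : R) : measurable_fun setT f ->
  measurable [set x | t <= f x].
Proof.
move=> mf; rewrite -[X in measurable X]setTI.
have -> : [set x | t <= f x] = f @^-1` `[t, +oo[.
  by apply/seteqP; split => x /=; rewrite in_itv/= andbT.
exact: mf.
Qed.

Lemma chernoff_pairs (h : R * R -> R) (c t : R) :
  measurable_fun setT h ->
  (\int[gamma \x gamma]_y (expR (h y))%:E = c%:E)%E ->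
  (P [set x | (t <= \sum_(i < n) h (U i x, V i x))%R] <=
    (expR (- t) * c ^+ n)%:E)%E.
Proof.
move=> mh hc.
pose X : {RV P >-> R} := mfun_Sub (mem_set (measurable_sum_pairs mh)).
apply: le_trans (@chernoff _ _ _ P X 1 t ltr01) _.
rewrite mul1r muleC EFinM le_eqVlt; apply/orP; left; apply/eqP; congr (_ * _)%E.
rewrite /mmt_gen_fun unlock.
have mg : measurable_fun setT (expR \o h) by exact: measurableT_comp.
have g0 y : 0 <= (expR \o h) y by exact: expR_ge0.
have := @expectation_prod_pairs _ _ _ T _ _ R P gamma gamma n U V (expR \o h) c.
move=> /(_ indep mU mV mg g0 hc) <-.
apply: eq_integral => x _ /=; congr EFin; rewrite mulr1 expR_sum.
  by apply: eq_bigr.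
Qed.

Lemma chernoff_pairs_sym (h : R * R -> R) (c c' l b x : R) :
  measurable_fun setT h -> 0 < l ->
  (\int[gamma \x gamma]_y (expR (l * h y))%:E = c%:E)%E ->
  (\int[gamma \x gamma]_y (expR (- l * h y))%:E = c'%:E)%E ->
  c <= expR b -> c' <= expR b ->
  (P [set w | (x <= `|\sum_(i < n) h (U i w, V i w)|)%R] <=
    (2 * expR (n%:R * b - l * x))%:E)%E.
Proof.
move=> mh l0 hc hc' cb cb'; set S := fun w => \sum_(i < n) h (U i w, V i w).
have mS : measurable_fun setT S by exact: measurable_sum_pairs.
have one_sided (e k : R) :
    (\int[gamma \x gamma]_y (expR (e * h y))%:E = k%:E)%E -> k <= expR b ->
    (P [set w | (l * x <= e * S w)%R] <= (expR (n%:R * b - l * x))%:E)%E.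
  move=> hk kb; have k0 : 0 <= k.
    rewrite -lee_fin -hk; apply: integral_ge0 => y _.
    by rewrite lee_fin expR_ge0.
  have meh : measurable_fun setT (fun y => e * h y) by exact: measurable_funM.
  have := chernoff_pairs (l * x) meh hk.
  have -> : [set w | l * x <= \sum_(i < n) e * h (U i w, V i w)] =
            [set w | l * x <= e * S w].
    by apply/seteqP; split => w /=; rewrite /S mulr_sumr.
  move=> /le_trans; apply; rewrite lee_fin addrC expRD ler_pM2l ?expR_gt0//.
  rewrite expRM_natl; apply: lerXn2r; rewrite ?nnegrE ?expR_ge0//.
rewrite mulr2n mulrDl mul1r EFinD.
apply: le_trans (leeD (one_sided _ _ hc cb) (one_sided _ _ hc' cb')).
apply: le_trans (measureU2 _ _ _).
- apply: le_measure; rewrite ?inE.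
  + by apply: measurable_level; exact: measurableT_comp.
  + by apply: measurableU; apply: measurable_level; exact: measurable_funM.
  + move=> w /=; rewrite ler_normr => /orP[xS|xS]; [left|right].
      by rewrite ler_pM2l.
    by rewrite mulNr -mulrN ler_pM2l.
- by apply: measurable_level; exact: measurable_funM.
- by apply: measurable_level; exact: measurable_funM.
Qed.

(** As [l] tends to 0, [rho] may tend to 0 too, and the exponent approaches the
    value [n * l ^+ 2 / 2] for a normal variable of variance [n]. This sharp
    constant is what makes the threshold [r > 1] reachable. *)
Lemma tail_sum_mul (l rho : R) :
  0 < l -> 0 <= rho -> l ^+ 2 * (1 + rho) <= rho ->
  (P [set w | (n%:R * l <= `|\sum_(i < n) U i w * V i w|)%R] <=
    (2 * expR (- (n%:R * l ^+ 2 * ((1 - rho) / 2))))%:E)%E.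
Proof.
move=> l0 rho0 lrho; have l21 : l ^+ 2 < 1 by have := sqr_ge0 l; nra.
have le_b : (Num.sqrt (1 - l ^+ 2))^-1 <= expR (l ^+ 2 * ((1 + rho) / 2)).
  apply: le_trans (invr_sqrt_le_expR l21) _; rewrite ler_expR.
  rewrite ler_wpM2l ?sqr_ge0// invfM ler_pdivrMl//.
  rewrite [leRHS](_ : _ = 1 + rho); last by field.
  rewrite -[leLHS]mul1r ler_pdivrMr; nra.
have mh : measurable_fun setT (fun y : R * R => y.1 * y.2).
  exact: measurable_funM.
have := @chernoff_pairs_sym _ _ _ l (l ^+ 2 * ((1 + rho) / 2)) (n%:R * l) mh l0
  (normal_mgf_mul l21).
have := @normal_mgf_mul _ (- l); rewrite sqrrN => /(_ l21) h /(_ _ h le_b le_b).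
move=> /le_trans; apply; rewrite lee_fin le_eqVlt; apply/orP; left; apply/eqP.
congr (2 * expR _); by field.
Qed.

Lemma tail_sum_sqr (l : R) : 0 < l -> l <= 1 ->
  (P [set w | (n%:R * l <= `|\sum_(i < n) (U i w ^+ 2 - 1)|)%R] <=
    (2 * expR (- (n%:R * l ^+ 2 / 16)))%:E)%E.
Proof.
(* t = l / 8 keeps 2 t away from 1 for all l <= 1; a sharper choice would only
   improve the constant 16 *)
move=> l0 l1; pose t := l / 8.
have le_b (e : R) : `|e| <= t ->
    expR (- e) / Num.sqrt (1 - 2 * e) <= expR (l ^+ 2 / 16).
  rewrite ler_norml => /andP[e1 e2].
  have e3 : 2 * e < 1 by rewrite /t in e2; lra.
  apply: (@le_trans _ _ (expR (- e) * expR (2 * e / (2 * (1 - 2 * e))))).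
    by rewrite ler_pM2l ?expR_gt0// invr_sqrt_le_expR.
  rewrite -expRD ler_expR.
  have -> : - e + 2 * e / (2 * (1 - 2 * e)) = 2 * e ^+ 2 / (1 - 2 * e).
    by field; rewrite gt_eqF//; lra.
  rewrite ler_pdivrMr; last lra.
  have : e ^+ 2 <= l ^+ 2 / 64 by rewrite /t in e1 e2; nra.
  rewrite /t in e1 e2; nra.
have mh : measurable_fun setT (fun y : R * R => y.1 ^+ 2 - 1).
  by apply: measurable_funB => //; exact: measurable_funX.
have t0 : 0 < t by rewrite divr_gt0.
have t1 : 2 * t < 1 by rewrite /t; lra.
have t2 : 2 * - t < 1 by lra.
have := @chernoff_pairs_sym _ _ _ t (l ^+ 2 / 16) (n%:R * l) mh t0
  (normal_mgf_fst t1) (normal_mgf_fst t2).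
rewrite !le_b ?normrN ?gtr0_norm// => /(_ isT isT).
move=> /le_trans; apply; rewrite lee_fin le_eqVlt; apply/orP; left; apply/eqP.
congr (2 * expR _); rewrite /t; by field.
Qed.

End tail_bounds.

(** * Independent pairs in the Gaussian linear model *)

Section gaussian_model_pairs.
Context d (T : measurableType d) (R : realType) (P : probability T R).
Local Notation gamma := (@normal_prob R 0 1).

Lemma sigma_family_preimage (I : Type) (Z : I -> {RV P >-> R}) i (A : set R) :
  measurable A -> sigma_family Z (Z i @^-1` A).
Proof.
move=> mA; apply: sub_sigma_algebra; exists i => //.
by exists A => //; rewrite setTI.
Qed.

Lemma sigma_familyI (I : Type) (Z : I -> {RV P >-> R}) (A B : set T) :
  sigma_family Z A -> sigma_family Z B -> sigma_family Z (A `&` B).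
Proof.
exact: (@measurableI _ (g_sigma_algebraType
  (\bigcup_i g_sigma_algebra_preimage (Z i)))).
Qed.

Lemma sigma_family_bigcap (I : Type) (Z : I -> {RV P >-> R}) n
    (A : 'I_n -> set T) :
  (forall i, sigma_family Z (A i)) -> sigma_family Z (\bigcap_i A i).
Proof.
move=> ZA; apply: (@fin_bigcap_measurable _ (g_sigma_algebraType
  (\bigcup_i g_sigma_algebra_preimage (Z i)))) => // i _; exact: ZA.
Qed.

Lemma mutually_independent_setT n (G : 'I_n -> set (set T))
    (A : 'I_n -> set T) :
  mutually_independent P G -> (forall i, G i (A i)) ->
  (P (\bigcap_i A i) = \prod_(i < n) P (A i))%E.
Proof.
move=> indep GA; have := indep [set: 'I_n]%SET A (fun i _ => GA i).
rewrite (_ : \bigcap_(i in _) A i = \bigcap_i A i).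
  by move=> ->; apply: eq_bigl => i; rewrite finset.in_setT.
by apply: eq_bigcapl; split => i //= _; rewrite finset.in_setT.
Qed.

Lemma std_normal_preimage (Z : {RV P >-> R}) (A : set R) :
  std_normal Z -> measurable A -> P (Z @^-1` A) = gamma A.
Proof. by move=> sZ mA; rewrite -sZ. Qed.

Variables (n p : nat).
Variables (X : 'I_n -> 'I_p -> {RV P >-> R}) (E : 'I_n -> {RV P >-> R}).
Hypothesis model : gaussian_model X E.

(** The rows are independent, and inside each row so are the coordinates. *)
Lemma iid_pairs_columns (j l : 'I_p) : j != l ->
  iid_pairs P gamma gamma (fun i => X i j) (fun i => X i l).
Proof.
move=> jl A B mA mB.
rewrite (mutually_independent_setT (rows_independent model)); last first.
  move=> i; apply: sigma_familyI.
    exact: (@sigma_family_preimage _ (X i) j (A i) (mA i)).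
  exact: (@sigma_family_preimage _ (X i) l (B i) (mB i)).
apply: eq_bigr => i _; have [sN indep] := rows_std_normal model i.
pose F k := if k == j then X i j @^-1` A i else X i l @^-1` B i.
have := indep [set j; l]%SET F.
have -> : \bigcap_(k in [set` [set j; l]%SET]) F k =
    X i j @^-1` A i `&` X i l @^-1` B i.
  apply/seteqP; split => w /=.
    move=> h; split; first by have := h j; rewrite /F /= !inE !eqxx/=; apply.
    by have := h l; rewrite /F /= !inE eqxx eq_sym (negbTE jl) orbT; apply.
  move=> [hA hB] k /=.
  rewrite !inE => /orP[/eqP ->|/eqP ->]; rewrite /F ?eqxx//.
  by rewrite eq_sym (negbTE jl).
move=> ->.
  rewrite big_setU1/= ?inE// big_set1 /F eqxx eq_sym (negbTE jl).
  by rewrite (std_normal_preimage (sN j) (mA i))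
    (std_normal_preimage (sN l) (mB i)).
move=> k; rewrite !inE => /orP[/eqP ->|/eqP ->]; rewrite /F ?eqxx.
  by exists (A i); [exact: mA|rewrite setTI].
by rewrite eq_sym (negbTE jl); exists (B i); [exact: mB|rewrite setTI].
Qed.

(** The design and the noise are independent, the rows of the column are
    independent, and so are the entries of the noise. *)
Lemma iid_pairs_column_noise (j : 'I_p) :
  iid_pairs P gamma gamma (fun i => X i j) E.
Proof.
move=> A B mA mB.
have -> : \bigcap_i (X i j @^-1` A i `&` E i @^-1` B i) =
    (\bigcap_i X i j @^-1` A i) `&` (\bigcap_i E i @^-1` B i).
  by rewrite bigcapI.
rewrite (design_noise_independent model); first last.
- apply: sigma_family_bigcap => i.
  exact: (@sigma_family_preimage _ E i (B i) (mB i)).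
- apply: sigma_family_bigcap => i.
  exact: (@sigma_family_preimage _ (fun ij => X ij.1 ij.2) (i, j) (A i) (mA i)).
rewrite (mutually_independent_setT (rows_independent model)); last first.
  by move=> i; exact: (@sigma_family_preimage _ (X i) j (A i) (mA i)).
rewrite (mutually_independent_setT (noise_independent model)); last first.
  by move=> i; exists (B i); [exact: mB|rewrite setTI].
rewrite -big_split; apply: eq_bigr => i _.
have [sN _] := rows_std_normal model i.
by rewrite (std_normal_preimage (sN j) (mA i))
  (std_normal_preimage (noise_std_normal model i) (mB i)).
Qed.

End gaussian_model_pairs.

(** * Union bound over incoherence and score events *)

Section union_bound.
Context d (T : measurableType d) (R : realType) (P : probability T R).
Variables (n p : nat).
Variables (X : 'I_n -> 'I_p -> {RV P >-> R}) (E : 'I_n -> {RV P >-> R}).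
Hypothesis model : gaussian_model X E.

Lemma measure_finite_union_le (I : finType) (Q : pred I) (F : I -> set T)
    (c : R) :
  (forall i, measurable (F i)) -> (forall i, Q i -> (P (F i) <= c%:E)%E) ->
  (P (\big[setU/set0]_(i | Q i) F i) <= (#|Q|%:R * c)%:E)%E.
Proof.
move=> mF Fc; have -> : (#|Q|%:R * c)%:E = (\sum_(i | Q i) c%:E)%E.
  by rewrite sumEFin sumr_const mulr_natl.
apply: le_trans (lee_sum _ Fc).
suff [] : measurable (\big[setU/set0]_(i | Q i) F i) /\
    (P (\big[setU/set0]_(i | Q i) F i) <= \sum_(i | Q i) P (F i))%E by [].
elim/big_rec2: _ => [|i y B Qi [mB IH]]; first by rewrite measure0.
split; first exact: measurableU.
by apply: le_trans (measureU2 _ _ _) _ => //; rewrite leeD.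
Qed.

Definition incoherent (eta : R) (ij : 'I_p * 'I_p) : set T :=
  [set w | n%:R * eta <=
    `|((design X w)^T *m design X w) ij.1 ij.2 - n%:R *+ (ij.1 == ij.2)|].

Definition large_score (l : R) (j : 'I_p) : set T :=
  [set w | n%:R * l <= `|((design X w)^T *m noise E w) j 0|].

Let gramE w i j : ((design X w)^T *m design X w) i j = \sum_k X k i w * X k j w.
Proof. by rewrite mxE; apply: eq_bigr => k _; rewrite !mxE. Qed.

Let scoreE w j : ((design X w)^T *m noise E w) j 0 = \sum_k X k j w * E k w.
Proof. by rewrite mxE; apply: eq_bigr => k _; rewrite !mxE. Qed.

Lemma measurable_incoherent eta ij : measurable (incoherent eta ij).
Proof.
rewrite -[X in measurable X]setTI.
have -> : incoherent eta ij =
    (fun w => `|\sum_k X k ij.1 w * X k ij.2 w - n%:R *+ (ij.1 == ij.2)|) @^-1`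
    `[n%:R * eta, +oo[.
  by apply/seteqP; split => w; rewrite /incoherent/= in_itv/= andbT gramE.
suff: measurable_fun setT
  (fun w => `|\sum_k X k ij.1 w * X k ij.2 w - n%:R *+ (ij.1 == ij.2)|)
  by apply.
apply: measurableT_comp => //; apply: measurable_funB => //.
by apply: measurable_sum => k; exact: measurable_funM.
Qed.

Lemma measurable_large_score l j : measurable (large_score l j).
Proof.
rewrite -[X in measurable X]setTI.
have -> : large_score l j =
    (fun w => `|\sum_k X k j w * E k w|) @^-1` `[n%:R * l, +oo[.
  by apply/seteqP; split => w; rewrite /large_score/= in_itv/= andbT scoreE.
suff: measurable_fun setT (fun w => `|\sum_k X k j w * E k w|) by apply.
apply: measurableT_comp => //.
by apply: measurable_sum => k; exact: measurable_funM.
Qed.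

Lemma incoherent_le (eta : R) ij : 0 < eta -> eta <= 1 / 2 ->
  (P (incoherent eta ij) <= (2 * expR (- (n%:R * eta ^+ 2 / 16)))%:E)%E.
Proof.
case: ij => i j eta0 eta1; have [->|ij] := eqVneq i j.
  have := tail_sum_sqr (iid_pairs_column_noise model j).
  move=> /(_ (fun k => measurable_funPT (X k j))
    (fun k => measurable_funPT (E k))).
  move=> /(_ eta eta0 _); rewrite (le_trans eta1)//; last lra.
  move=> /(_ isT); apply: le_trans.
  rewrite le_eqVlt; apply/orP; left; apply/eqP.
  have D w : \sum_k (X k j w ^+ 2 - 1) = \sum_k X k j w * X k j w - n%:R.
    by rewrite sumrB sumr_const card_ord.
  congr (P _); apply/seteqP; split => w;
  by rewrite /incoherent/= eqxx gramE mulr1n D.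
have := tail_sum_mul (iid_pairs_columns model ij).
move=> /(_ (fun k => measurable_funPT (X k i))
    (fun k => measurable_funPT (X k j))).
move=> /(_ eta (1 / 2) eta0); rewrite divr_ge0// => /(_ isT).
have -> : eta ^+ 2 * (1 + 1 / 2) <= 1 / 2 by nra.
move=> /(_ isT) h; apply: (@le_trans _ _
  (2 * expR (- (n%:R * eta ^+ 2 * ((1 - 1 / 2) / 2))))%:E).
  apply: le_trans h; rewrite le_eqVlt; apply/orP; left; apply/eqP.
  congr (P _); apply/seteqP; split => w;
  by rewrite /incoherent/= (negbTE ij) gramE mulr0n subr0.
rewrite lee_fin ler_pM2l// ler_expR lerN2.
have : 0 <= n%:R * eta ^+ 2 :> R by rewrite mulr_ge0 ?sqr_ge0.
lra.
Qed.

Lemma large_score_le (theta L rho : R) j :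
  (0 < n)%N -> 0 < theta * L -> 0 <= rho ->
  theta * L / n%:R * (1 + rho) <= rho ->
  (P (large_score (Num.sqrt (theta * L / n%:R)) j) <=
    (2 * expR (- (theta * L * ((1 - rho) / 2))))%:E)%E.
Proof.
move=> n0 tL rho0 h; have nR : 0 < n%:R :> R by rewrite ltr0n.
have q0 : 0 < theta * L / n%:R by rewrite divr_gt0.
have := tail_sum_mul (iid_pairs_column_noise model j).
move=> /(_ (fun k => measurable_funPT (X k j))
    (fun k => measurable_funPT (E k))).
move=> /(_ (Num.sqrt (theta * L / n%:R)) rho).
rewrite sqrtr_gt0 q0 rho0 sqr_sqrtr ?(ltW q0)// h => /(_ isT isT isT).
rewrite [n%:R * (theta * L / n%:R)]mulrC divfK ?gt_eqF// => {}h.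
apply: le_trans h.
rewrite le_eqVlt; apply/orP; left; apply/eqP.
by congr (P _); apply/seteqP; split => w; rewrite /large_score/= scoreE mulrC.
Qed.

End union_bound.

Section selection_error_bound.
Context d (T : measurableType d) (R : realType) (P : probability T R).

(** The scores are held to different levels on and off the support: the sharp
    level [2 * (1 + kappa) * L] is forced by the p indices off the support,
    while the few indices of the support allow the negligible level
    [kappa ^+ 2 * L]. *)
Lemma selection_error_le n p (X : 'I_n -> 'I_p -> {RV P >-> R})
    (E : 'I_n -> {RV P >-> R}) (S : 'M[R]_(n, p) -> 'cV[R]_n -> {set 'I_p})
    (s : nat) (kappa eta L r a : R) (b : 'cV[R]_p) :
  gaussian_model X E -> bss_rule s S -> estimator_measurable X E S ->
  (s <= p)%N -> (0 < n)%N -> 0 < L -> 0 < kappa -> kappa <= 1 / 4 ->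
  kappa * (4 * r + 10) <= r - 1 -> 1 < r ->
  0 < a -> n%:R * a ^+ 2 = 2 * r * L ->
  2 * s%:R ^+ 2 * eta <= kappa -> 0 < eta -> eta <= 1 / 2 ->
  2 * (1 + kappa) * L / n%:R * (1 + kappa / 4) <= kappa / 4 ->
  signal_class s a b ->
  (selection_error X E S b <=
    (p%:R ^+ 2 * (2 * expR (- (n%:R * eta ^+ 2 / 16))) +
     p%:R * (2 * expR (- ((1 + kappa / 2) * L))) +
     s%:R * (2 * expR (- (kappa ^+ 2 * L / 4))))%:E)%E.
Proof.
move=> model rule mS sp n0 L0 k0 k4 kr r1 a0 aE etas eta0 eta2 lk bclass.
have nR : 0 < n%:R :> R by rewrite ltr0n.
have [cb _] := bclass.
pose lN := Num.sqrt (2 * (1 + kappa) * L / n%:R).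
pose lS := Num.sqrt (kappa ^+ 2 * L / n%:R).
pose BI := \big[setU/set0]_(ij | true) incoherent X eta ij.
pose BN := \big[setU/set0]_(j | true) large_score X E lN j.
pose BS := \big[setU/set0]_(j | j \in supp b) large_score X E lS j.
have mBI : measurable BI.
  by apply: bigsetU_measurable => ij _; exact: measurable_incoherent.
have mBN : measurable BN.
  by apply: bigsetU_measurable => ij _; exact: measurable_large_score.
have mBS : measurable BS.
  by apply: bigsetU_measurable => ij _; exact: measurable_large_score.
have sub : [set w | S (design X w) (response X E b w) <> supp b] `<=`
    BI `|` BN `|` BS.
  move=> w /= /eqP Sb; apply: contrapT => /not_orP[/not_orP[nI nN] nS].
  have [cD Dmin] := rule sp (design X w) (response X E b w).
  have := Dmin _ cb; apply/negP; rewrite -ltNge.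
  have score_sq l j : 0 <= l -> ~ large_score X E l j w ->
      ((design X w)^T *m noise E w) j 0 ^+ 2 <= n%:R * (n%:R * l ^+ 2).
    move=> l0 /negP; rewrite -ltNge => zl.
    rewrite mulrA -expr2 -exprMn -[leLHS]real_normK ?num_real//.
    by apply: lerXn2r; rewrite ?nnegrE ?mulr_ge0 ?(ltW zl).
  apply: (@support_beats_subset _ _ _ _ b (noise E w) s kappa eta L r a) => //.
  - move=> i j; rewrite leNgt; apply/negP => /ltW ij; apply: nI.
    by rewrite /BI (bigD1 (i, j))//=; left.
  - move=> j _; have := @score_sq lN j.
    rewrite sqr_sqrtr; last by rewrite divr_ge0// ?mulr_ge0//; lra.
    rewrite [n%:R * (2 * _ * _ / _)]mulrC divfK ?gt_eqF//.
    apply; first exact: sqrtr_ge0.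
    move=> jN; apply: nN; rewrite /BN (bigD1 j)//=; by left.
  - move=> j jb; have := @score_sq lS j.
    rewrite sqr_sqrtr; last by rewrite divr_ge0// ?mulr_ge0 ?sqr_ge0// ltW.
    rewrite [n%:R * (_ * _ / _)]mulrC divfK ?gt_eqF//.
    apply; first exact: sqrtr_ge0.
    move=> jN; apply: nS; rewrite /BS (bigD1 j)//=; by left.
have mErr : measurable [set w | S (design X w) (response X E b w) <> supp b].
  have -> : [set w | S (design X w) (response X E b w) <> supp b] =
    ~` [set w | S (design X w) (response X E b w) = supp b] by [].
  by apply: measurableC; exact: mS.
have kL : 0 < kappa ^+ 2 * L by rewrite mulr_gt0 ?exprn_gt0.
rewrite /selection_error; apply: (@le_trans _ _ (P (BI `|` BN `|` BS))).
  apply: le_measure => //; rewrite ?inE//.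
  by apply: measurableU => //; exact: measurableU.
apply: le_trans (measureU2 _ _ _) _ => //; first exact: measurableU.
rewrite EFinD; apply: leeD; last first.
  rewrite -cb; apply: measure_finite_union_le => j.
    exact: measurable_large_score.
  move=> _; have := @large_score_le _ _ _ P _ _ X E model (kappa ^+ 2) L (1 / 2)
    j n0 kL.
  rewrite divr_ge0// => /(_ isT).
  have -> : kappa ^+ 2 * L / n%:R * (1 + 1 / 2) <= 1 / 2.
    have u0 : 0 < L / n%:R by rewrite divr_gt0.
    move: lk; rewrite -!(mulrA _ L _^-1); move: (L / n%:R) u0 => u u0 lk.
    have : u <= 1 / 4 by nra.
    have : kappa ^+ 2 <= 1 by nra.
    nra.
  move=> /(_ isT) h; apply: le_trans h _.
  rewrite lee_fin le_eqVlt; apply/orP; left.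
  by apply/eqP; congr (2 * expR _); field.
apply: le_trans (measureU2 _ _ _) _ => //.
rewrite EFinD; apply: leeD.
  have -> : p%:R ^+ 2 = #|predT : pred ('I_p * 'I_p)|%:R :> R.
    by rewrite cardT -cardE card_prod card_ord natrM expr2.
  apply: measure_finite_union_le => ij; first exact: measurable_incoherent.
  by move=> _; exact: (incoherent_le model).
have -> : p%:R = #|predT : pred 'I_p|%:R :> R by rewrite cardT -cardE card_ord.
apply: measure_finite_union_le => j; first exact: measurable_large_score.
move=> _; have tL : 0 < 2 * (1 + kappa) * L by rewrite !mulr_gt0//; lra.
have := @large_score_le _ _ _ P _ _ X E model (2 * (1 + kappa)) L (kappa / 4)
  j n0 tL.
have k40 : 0 <= kappa / 4 by lra.
move=> /(_ k40 lk) h; apply: le_trans h _.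
rewrite lee_fin ler_pM2l// ler_expR lerN2.
have -> : 2 * (1 + kappa) * L * ((1 - kappa / 4) / 2) =
  ((1 + kappa) * (1 - kappa / 4)) * L by field.
rewrite ler_pM2r//; nra.
Qed.

End selection_error_bound.

(** * Asymptotics *)

Section asymptotics.
Context {R : realType}.
Implicit Types (k r K L y : R) (p s : nat).

Lemma expRN_le_inv y : 0 < y -> expR (- y) <= y^-1.
Proof.
move=> y0; rewrite expRN lef_pV2 ?posrE ?expR_gt0//.
by apply: le_trans (expR_ge1Dx y); rewrite lerDr.
Qed.

Lemma expRN_le_inv_sqr y : 0 < y -> expR (- y) <= 2 / y ^+ 2.
Proof.
move=> y0; rewrite expRN -[leRHS]invrK.
rewrite lef_pV2 ?posrE ?expR_gt0 ?invr_gt0 ?divr_gt0 ?exprn_gt0//.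
apply: le_trans (expR_ge1Dxn 1 (ltW y0)).
by rewrite invf_div !factS fact0 lerDr.
Qed.

(** One term of the exponential series of [p%:R `^ k = expR (k * ln p%:R)]. The
    sixth power suits a union over pairs of columns at incoherence [eta] of
    order [(ln p%:R) ^- 2]: the exponent [n * eta ^+ 2] then exceeds every
    multiple of [ln p%:R]. *)
Lemma nobs_ge k p : 0 < k -> (0 < p)%N -> 0 <= ln p%:R :> R ->
  (k * ln p%:R) ^+ 6 / 720 <= (nobs k p)%:R.
Proof.
move=> k0 p0 L0; have pR : 0 < p%:R :> R by rewrite ltr0n.
have := truncnS_gt (p%:R `^ k); rewrite -/(nobs k p) /powR gt_eqF// -natr1.
have := expR_ge1Dxn 5 (mulr_ge0 (ltW k0) L0).
rewrite (_ : 6`! = 720)//; lra.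
Qed.

Lemma signal_class_nonempty s p (a : R) : (s <= p)%N -> 0 < a ->
  exists b : 'cV[R]_p, signal_class s a b.
Proof.
move=> sp a0; pose A := [set j in take s (enum 'I_p)]%SET.
have cA : #|A| = s.
  rewrite cardsE (card_uniqP _) ?take_uniq ?enum_uniq// size_takel//.
  by rewrite size_enum_ord.
exists (\col_j if j \in A then a else 0).
rewrite /signal_class/=.
have -> : supp (\col_j if j \in A then a else 0) = A.
  apply/setP => j; rewrite finset.inE mxE.
  by case: ifP => _; rewrite ?eqxx// gt_eqF.
by split=> [|j jA]; [exact: cA|rewrite mxE jA gtr0_norm].
Qed.

Section fixed_p.
Context d (T : measurableType d) (P : probability T R) (k r : R) (p s : nat).
Variables (X : 'I_(nobs k p) -> 'I_p -> {RV P >-> R})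
  (E : 'I_(nobs k p) -> {RV P >-> R})
  (S : 'M[R]_(nobs k p, p) -> 'cV[R]_(nobs k p) -> {set 'I_p}).

(** A supremum over the empty class would be -oo. *)
Lemma max_selection_error_ge0 (a : R) : (s <= p)%N -> 0 < a ->
  (0 <= max_selection_error X E S s a)%E.
Proof.
move=> sp a0; have [b bC] := signal_class_nonempty sp a0.
apply: (@le_trans _ _ (selection_error X E S b)); first exact: measure_ge0.
by apply: ereal_sup_ubound; exists b.
Qed.

(** The three terms of [selection_error_le] are at most 2 exp (- L),
    2 exp (- kappa L / 2) and 2 K L exp (- kappa^2 L / 4). *)
Lemma max_selection_error_le (kappa K : R) :
  let L : R := ln p%:R in let c := k ^+ 6 / 720 in
  gaussian_model X E -> bss_rule s S -> estimator_measurable X E S ->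
  0 < k -> 1 < r -> kappa = (r - 1) / (4 * r + 10) -> 1 <= K ->
  1 <= L -> 16 / (c * kappa) <= L -> 192 * K ^+ 4 / (c * kappa ^+ 2) <= L ->
  2 * K <= L -> s%:R <= K * L ->
  (0 <= max_selection_error X E S s (min_signal k r p) <=
   ((2 + 4 / kappa + 64 * K / kappa ^+ 4) / L)%:E)%E.
Proof.
move=> L c model rule mS k0 r1 kE K1 L1 L2 L3 L4 sK.
have r10 : 0 < 4 * r + 10 by lra.
have kr : kappa * (4 * r + 10) = r - 1 by rewrite kE divfK// gt_eqF.
have kap0 : 0 < kappa by rewrite kE divr_gt0//; lra.
have kap4 : kappa <= 1 / 4 by rewrite kE ler_pdivrMr//; lra.
have L0 : 0 < L by lra.
have K0 : 0 < K by lra.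
have p0 : (0 < p)%N.
  by rewrite lt0n; apply/eqP => p0; move: L0; rewrite /L p0 ln0// ltxx.
have pE : p%:R = expR L by rewrite lnK// posrE ltr0n.
have c0 : 0 < c.
  by rewrite /c; apply: divr_gt0; [exact: exprn_gt0|rewrite ltr0n].
have nL : c * L ^+ 6 <= (nobs k p)%:R.
  by have := nobs_ge k0 p0 (ltW L0); rewrite exprMn mulrAC.
clearbody c.
set n := nobs k p in nL *.
have L5 : L <= L ^+ 5 by rewrite -{1}(expr1 L) ler_weXn2l.
have L6 : 0 < c * L ^+ 6 by rewrite mulr_gt0// exprn_gt0.
have nR : 0 < n%:R :> R by lra.
have n0 : (0 < n)%N by rewrite -(ltr0n R).
have sp : (s <= p)%N.
  rewrite -(ler_nat R) pE (le_trans sK)//.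
  apply: le_trans (expR_ge1Dxn 1 (ltW L0)); rewrite !factS fact0.
  have : K * L <= L / 2 * L by rewrite ler_wpM2r; lra.
  rewrite expr2; lra.
have aE2 : 0 < 2 * r * L / n%:R by rewrite divr_gt0// !mulr_gt0//; lra.
have a0 : 0 < min_signal k r p by rewrite /min_signal sqrtr_gt0.
rewrite max_selection_error_ge0//=.
(* the largest incoherence allowed by [support_beats_subset] when s = K L *)
pose eta := kappa / (2 * K ^+ 2 * L ^+ 2).
have KL : 1 <= K ^+ 2 * L ^+ 2 by rewrite -exprMn exprn_ege1// mulr_ege1.
have eta0 : 0 < eta by rewrite divr_gt0// -mulrA mulr_gt0//; lra.
have eta2 : eta <= 1 / 2.
  rewrite /eta ler_pdivrMr; last by rewrite -mulrA; lra.
  by rewrite -mulrA; lra.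
have etas : 2 * s%:R ^+ 2 * eta <= kappa.
  have h : s%:R ^+ 2 <= K ^+ 2 * L ^+ 2.
    by rewrite -exprMn; apply: lerXn2r; rewrite ?nnegrE// mulr_ge0//; lra.
  have -> : 2 * s%:R ^+ 2 * eta = s%:R ^+ 2 / (K ^+ 2 * L ^+ 2) * kappa.
    by rewrite /eta; field; rewrite !gt_eqF//; lra.
  rewrite -[leRHS]mul1r ler_pM2r// ler_pdivrMr; lra.
have Ln : 16 * L <= kappa * n%:R.
  have : kappa * (c * L ^+ 6) <= kappa * n%:R by rewrite ler_pM2l.
  move: L2; rewrite ler_pdivrMr ?mulr_gt0// => L2.
  have : 16 <= L ^+ 5 * (c * kappa).
    apply: le_trans L2 _; rewrite ler_pM2r// mulr_gt0//.
  rewrite exprS; nra.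
have lk : 2 * (1 + kappa) * L / n%:R * (1 + kappa / 4) <= kappa / 4.
  have h4 : 2 * (1 + kappa) * (1 + kappa / 4) <= 4 by nra.
  have h5 : 2 * (1 + kappa) * (1 + kappa / 4) * L <= 4 * L by rewrite ler_pM2r.
  rewrite mulrAC ler_pdivrMr// mulrAC; lra.
apply: ge_ereal_sup => _ [b bC <-].
have a2 : n%:R * min_signal k r p ^+ 2 = 2 * r * L.
  by rewrite /min_signal sqr_sqrtr ?ltW// mulrC divfK// gt_eqF.
have kr' : kappa * (4 * r + 10) <= r - 1 by rewrite kr.
apply: le_trans (selection_error_le model rule mS sp n0 L0 kap0 kap4 kr' r1 a0
  a2 etas eta0 eta2 lk bC) _.
rewrite lee_fin pE [leRHS]mulrDl [X in _ <= X + _]mulrDl.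
apply: lerD; first apply: lerD.
- have neta : 3 * L <= n%:R * eta ^+ 2 / 16.
    have : 3 * L <= c * L ^+ 6 * eta ^+ 2 / 16.
      have -> : c * L ^+ 6 * eta ^+ 2 / 16 =
          c * kappa ^+ 2 * L ^+ 2 / (64 * K ^+ 4).
        by rewrite /eta; field; rewrite !gt_eqF//; lra.
      have K4 : 0 < 64 * K ^+ 4 by rewrite mulr_gt0 ?ltr0n ?exprn_gt0.
      rewrite ler_pdivlMr//.
      have ck : 0 < c * kappa ^+ 2 by rewrite mulr_gt0 ?exprn_gt0.
      move: L3; rewrite ler_pdivrMr// => L3.
      have : 192 * K ^+ 4 * L <= L * (c * kappa ^+ 2) * L by rewrite ler_pM2r.
      rewrite [L ^+ 2]expr2; lra.
    move=> /le_trans; apply; rewrite ler_pM2r// ler_pM2r// exprn_gt0//.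
  rewrite -expRM_natl mulrCA -expRD; apply: ler_wpM2l => //.
  apply: le_trans (expRN_le_inv L0); rewrite ler_expR; lra.
- have kL : 0 < kappa / 2 * L by rewrite !mulr_gt0.
  rewrite mulrCA -expRD.
  have -> : L + - ((1 + kappa / 2) * L) = - (kappa / 2 * L) by field.
  have -> : 4 / kappa / L = 2 * (kappa / 2 * L)^-1.
    by field; rewrite !gt_eqF.
  by rewrite ler_pM2l// expRN_le_inv.
- have kL : 0 < kappa ^+ 2 * L / 4 by rewrite !mulr_gt0// exprn_gt0.
  have := expRN_le_inv_sqr kL; set e := expR _ => he.
  have e0 : 0 <= e by exact: expR_ge0.
  apply: (@le_trans _ _ (K * L * (2 * (2 / (kappa ^+ 2 * L / 4) ^+ 2)))).
    by apply: ler_pM; rewrite ?mulr_ge0// ler_pM2l.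
  rewrite le_eqVlt; apply/orP; left; apply/eqP; field.
  by rewrite !gt_eqF.
Qed.

End fixed_p.
End asymptotics.

Lemma near_ln_ge (R : realType) (A : R) :
  \forall p \near \oo, A <= ln (p%:R : R).
Proof.
near=> p; have pA : expR A <= p%:R by near: p; exact: nbhs_infty_ger.
rewrite -[A]expRK ler_ln ?posrE ?expR_gt0//.
exact: lt_le_trans (expR_gt0 A) pA.
Unshelve. all: by end_near. Qed.

Lemma cvg_div_ln (R : realType) (M : R) :
  (M / ln (p%:R : R))%:E @[p --> \oo] --> 0%E.
Proof.
apply: cvg_EFin; first by near=> p.
rewrite -[X in _ --> X](mulr0 M); apply: cvgM; first exact: cvg_cst.
apply/gtr0_cvgV0; last by apply/cvgryPge => A; exact: near_ln_ge.
near=> p; apply: (@lt_le_trans _ _ 1) => //; near: p; exact: near_ln_ge.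
Unshelve. all: by end_near. Qed.

Theorem theorem4p1 (R : realType) :
  exists C0 : R, 0 < C0 /\
  forall (k r : R), 0 < k -> k < 1 -> 1 < r ->
  forall s : nat -> nat,
    (fun p : nat => (s p)%:R : R) =O_\oo (fun p : nat => ln p%:R : R) ->
    (\forall p \near \oo,
      (s p)%:R < C0 * sparsity_bound k (r - 1) * ln (p%:R : R)) ->
  forall (d : nat -> measure_display) (T : forall p : nat, measurableType (d p))
    (P : forall p : nat, probability (T p) R)
    (X : forall p : nat, 'I_(nobs k p) -> 'I_p -> {RV (P p) >-> R})
    (E : forall p : nat, 'I_(nobs k p) -> {RV (P p) >-> R})
    (S : forall p : nat,
      'M[R]_(nobs k p, p) -> 'cV[R]_(nobs k p) -> {set 'I_p}),
    (forall p : nat, gaussian_model (X p) (E p)) ->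
    (forall p : nat, bss_rule (s p) (S p)) ->
    (forall p : nat, estimator_measurable (X p) (E p) (S p)) ->
  (fun p : nat =>
     max_selection_error (X p) (E p) (S p) (s p) (min_signal k r p))
    @ \oo --> 0%E.
Proof.
(* whatever the value of C0, the sparsity is at most a multiple of ln p *)
exists 1; split => // k r k0 _ r1 s _ s_le d T P X E S model rule mS.
pose K := `|sparsity_bound k (r - 1)| + 1.
pose kappa := (r - 1) / (4 * r + 10).
pose M := 2 + 4 / kappa + 64 * K / kappa ^+ 4.
pose f p := (M / ln (p%:R : R))%:E.
apply: (@squeeze_cvge _ _ _ _ (cst 0%E) _ f);
  [|exact: cvg_cst|exact: cvg_div_ln].
near=> p; have L1 : 1 <= ln p%:R :> R by near: p; exact: near_ln_ge.
apply: (max_selection_error_le (model p) (rule p) (mS p) k0 r1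
  (erefl kappa)) => //.
- by rewrite /K lerDr.
- by near: p; exact: near_ln_ge.
- by near: p; exact: near_ln_ge.
- by near: p; exact: near_ln_ge.
- apply: (@le_trans _ _ (sparsity_bound k (r - 1) * ln p%:R)).
    by rewrite -[sparsity_bound _ _]mul1r ltW//; near: p.
  rewrite ler_wpM2r ?(le_trans ler01)// /K.
  by rewrite (le_trans (ler_norm _))// lerDl.
Unshelve. all: by end_near. Qed.
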